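(* Let $G_1$ and $G_2$ be finitely generated groups, each acting properly and cocompactly by cellular maps on a contractible complex $EG_i$. Then $$\operatorname{eqobdim}(G_1\times G_2)\ge \operatorname{eqobdim}(G_1)+\operatorname{eqobdim}(G_2)-1.$$
   Context: Configuration spaces: for a finite simplicial complex $K$, $\widetilde{\mathcal C}(K)\subset K\times K$ is the union of the cells $\sigma\times\tau$, written $(\sigma,\tau)$, with $\sigma,\tau$ disjoint simplices of $K$; $\iota$ is the free involution switching factors and $\mathcal C(K)=\widetilde{\mathcal C}(K)/\iota$. On cellular chains $\iota_*(\sigma,\tau)=(-1)^{\dim\sigma\dim\tau}(\tau,\sigma)$. $\mathbb Z$ and $\mathbb Z^-$ denote the integers with trivial, resp. nontrivial, $\mathbb Z/2$-action; $\epsilon$ is the sign of $(-1)^n$, so $\mathbb Z^{-\epsilon}$ is $\mathbb Z^-$ for $n$ even and $\mathbb Z$ for $n$ odd. $H_*(\mathcal C(K);\mathbb Z^{\pm})$ is the homology of $C_*(\widetilde{\mathcal C}(K))\otimes_{\mathbb Z[\mathbb Z/2]}\mathbb Z^{\pm}$, i.e. of the quotient of $C_*(\widetilde{\mathcal C}(K);\mathbb Z)$ by $c\sim\pm\iota_*c$. The $\mathbb Z/2$-valued van Kampen obstruction is $\mathrm{vk}^n_{\mathbb Z/2}(K)=c^*(w_1^n)\in H^n(\mathcal C(K);\mathbb Z/2)$, where $c:\mathcal C(K)\to\mathbb RP^\infty$ classifies the double cover and $w_1$ generates $H^1(\mathbb RP^\infty;\mathbb Z/2)$. Evaluation cycle: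 an evaluation $n$-cycle is a cellular $n$-cycle $\Phi=\sum(\sigma,\tau)\otimes a_{(\sigma,\tau)}$ on $\mathcal C(K)$ with coefficients in $\mathbb Z^{-\epsilon}$ such that $\langle \mathrm{vk}^n_{\mathbb Z/2}(K),\Phi_{\mathbb Z/2}\rangle\neq 0$, where $\Phi_{\mathbb Z/2}$ is the mod $2$ reduction, and for every $n$-simplex $\sigma$, $\sum_{v} a_{(\sigma,v)}=0$, the sum over vertices $v$ with $(\sigma,v)\in\widetilde{\mathcal C}(K)$; here $a_{(\sigma,v)}$ is the coefficient of the cell when written with ordered representative $(\sigma,v)$. Equivariant obstructor: for a group $H$, $S(H)$ is the subgroup generated by squares. Let $H$ be a finite group acting simplicially on $K$ (an $H$-complex); $H$ acts diagonally on $\mathcal C(K)$ and trivially on $\mathbb Z^{-\epsilon}$. $K$ is an equivariant $(n+1)$-obstructor if there are an evaluation $n$-cycle $\Phi$ and a nonempty subset $A\subset S(H)$ with $\sum_{h\in A}h_*\Phi=0$ (as cellular chains). Cones: $\operatorname{Cone}_\infty(K)=K\times[0,\infty)/K\times 0$. A proper map from it to a metric space is expanding if for any disjoint simplices $\sigma,\tau$ of $K$ the distance between the images of $\sigma\times[t,\infty)$ and $\tau\times[t,\infty)$ tends to $\infty$ as $t\to\infty$. $H$ acts on $\operatorname{Cone}_\infty(K)$ trivially on the $[0,\infty)$ factor. $H$-preserving maps: for a finitely generated group $G$, $EG$ denotes a contractible complex with a proper cocompact cellular $G$-action, with a proper $G$-invariant metric. A proper map $f:\operatorname{Cone}_\infty(K)\to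 EG$ is $H$-preserving if for each $h\in H$ there are $g_h\in G$ and $R>0$ such that $f\circ h$ is homotopic to $g_h\circ f$ by a proper homotopy $\{j^s\}_{s\in[0,1]}$ with $j^s(\operatorname{Cone}_\infty(\sigma))\subset N_R(f\circ h(\operatorname{Cone}_\infty(\sigma)))$ for all simplices $\sigma$ of $K$ and all $s$ ($N_R$ denotes $R$-neighborhood). For $h\in S(H)$ the elements $g_h$ are taken in $S(G)$, which is always possible. $\operatorname{eqobdim}(G)$ is the maximal $n+3$ such that there are a finite group $H$, an $H$-complex $K$ that is an equivariant $(n+1)$-obstructor, and an $H$-preserving proper expanding map $f:\operatorname{Cone}_\infty(K)\to EG$. *)

(* Defs.v *)
From HB Require Import structures.
From mathcomp Require Import all_boot all_order all_algebra all_fingroup.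
From mathcomp Require Import all_classical all_reals all_analysis.
Import Order.TTheory GRing.Theory Num.Theory numFieldNormedType.Exports.

Set Implicit Arguments.
Unset Strict Implicit.
Unset Printing Implicit Defensive.

Local Open Scope classical_set_scope.
Local Open Scope ring_scope.

Definition is_subgroup (G : groupType) (P : set G) : Prop :=
  [/\ P 1%g, (forall x y, P x -> P y -> P (x * y)%g)
    & (forall x, P x -> P (x^-1)%g)].

Definition generated (G : groupType) (A : set G) : set G :=
  smallest (@is_subgroup G) A.

Definition finitely_generated (G : groupType) : Prop :=
  exists2 A : set G, finite_set A & generated A = setT.

Definition square_subgroup (G : groupType) : set G :=
  generated (range (fun g : G => (g * g)%g)).

Record left_action (G : groupType) (X : Type) := LeftAction {
  lact :> G -> X -> X;
  lact1 : forall x, lact 1%g x = x;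
  lactM : forall g h x, lact (g * h)%g x = lact g (lact h x)
}.

(* The vertex set of a finite complex is identified with {0, ..., m-1}; the
   order of 'I_m is used below to orient every simplex. *)
Record scomplex (m : nat) := SComplex {
  simplices :> {set {set 'I_m}};
  simplex_neq0 : finset.set0 \notin simplices;
  simplex_face : forall s t : {set 'I_m},
    s \in simplices -> t \subset s -> t != finset.set0 -> t \in simplices;
  simplex_vertex : forall v : 'I_m, [set v]%SET \in simplices
}.

Record Hcomplex (H : finGroupType) (m : nat) (K : scomplex m) := HComplex {
  Hact :> left_action H 'I_m;
  Hact_simplicial : forall (h : H) (s : {set 'I_m}),
    s \in simplices K -> (Hact h @: s)%SET \in simplices K
}.

Section Chains.
Context {m : nat}.
Implicit Types (K : scomplex m) (s t : {set 'I_m}) (n : nat) (e : int).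

Definition cell : Type := ({set 'I_m} * {set 'I_m})%type.
Definition chain : Type := {ffun cell -> int}.

Definition sdim s : nat := #|s|.-1.

Definition dcells K : {set cell} :=
  [set p : cell | [&& p.1 \in simplices K, p.2 \in simplices K
                    & [disjoint p.1 & p.2]%B]]%SET.

Definition ncells K n : {set cell} :=
  [set p in dcells K | sdim p.1 + sdim p.2 == n]%N%SET.

Definition is_chain K n (c : chain) : Prop :=
  forall p, p \notin ncells K n -> c p = 0.

(* Coefficient of t in the (augmented) simplicial boundary of s; the sign is
   (-1)^i when v is the i-th vertex of s. *)
Definition incidence s t : int :=
  \sum_(v in s | t == (s :\ v)%SET)
    (-1) ^+ #|[set w in s | (w < v)%N]%SET|.

(* d(s, t) = (ds, t) + (-1)^dim(s) (s, dt), where the terms with an empty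
   factor are dropped because they are not in dcells K. *)
Definition boundary K (c : chain) : chain :=
  [ffun p : cell => if p \in dcells K then
     \sum_(q : cell) c q *
       (incidence q.1 p.1 * (q.2 == p.2)%:R
        + (-1) ^+ sdim q.1 * (q.1 == p.1)%:R * incidence q.2 p.2)
   else 0].

(* For e = 1, the action of the involution on cellular chains; in general,
   e times that action. *)
Definition twist e (c : chain) : chain :=
  [ffun p : cell => e * (-1) ^+ (sdim p.1 * sdim p.2) * c (p.2, p.1)].

(* Chains of the quotient with coefficients in the integers on which Z/2 acts
   by e = 1 or -1 are chains of the deleted product modulo c ~ twist e c. *)
Definition coinv_zero K n e (c : chain) : Prop :=
  exists2 d : chain, is_chain K n d & c = d - twist e d.

(* Coefficient in the class of c of the cell with ordered representative p. *)
Definition coef e (c : chain) (p : cell) : int := c p + twist e c p.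

Definition inversions (h : 'I_m -> 'I_m) s : nat :=
  #|[set vw : 'I_m * 'I_m | [&& vw.1 \in s, vw.2 \in s,
       (vw.1 < vw.2)%N & (h vw.2 < h vw.1)%N]]%SET|.

(* The sign compares the orientations: h maps the ordered simplex s to the
   ordered simplex h(s) up to a permutation with that many inversions. *)
Definition push (h : 'I_m -> 'I_m) (c : chain) : chain :=
  [ffun p : cell => \sum_(q : cell | ((h @: q.1)%SET, (h @: q.2)%SET) == p)
     (-1) ^+ (inversions h q.1 + inversions h q.2) * c q].

(* The barycentric subdivision of the deleted product is the order complex of
   its poset of cells.  A labelling lam of the cells by Z/2 that anticommutes
   with the involution is an equivariant simplicial map from it to
   EZ/2 = S^oo (the simplicial set whose k-simplices are the (k+1)-tuples of
   elements of Z/2), hence induces on quotients a map to BZ/2 = RP^oo that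
   classifies the double cover.  *)
Definition classifying K (lam : cell -> bool) : Prop :=
  forall p, p \in dcells K -> lam (p.2, p.1) = ~~ lam p.

(* Pullback of the generating 1-cocycle (a, b) |-> a + b of BZ/2. *)
Definition w1 (lam : cell -> bool) (p q : cell) : 'F_2 :=
  (lam p (+) lam q : nat)%:R.

(* n-th cup power of w1 (front face / back face formula) on the n-simplex of
   the subdivision with vertices f 0, ..., f n. *)
Definition w1_pow (lam : cell -> bool) n (f : {ffun 'I_n.+1 -> cell}) : 'F_2 :=
  \prod_(i < n) w1 lam (f (inord i)) (f (inord i.+1)).

Definition proper_face (q p : cell) : bool :=
  [&& q != p, q.1 \subset p.1 & q.2 \subset p.2].

Definition flags K n (p : cell) : {set {ffun 'I_n.+1 -> cell}} :=
  [set f : {ffun 'I_n.+1 -> cell} |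
    [&& f ord_max == p, [forall i, f i \in dcells K]
      & [forall i : 'I_n.+1, forall j : 'I_n.+1, (i < j)%N ==> proper_face (f i) (f j)]]]%SET.

(* Cellular cocycle representing the n-th power of w1: an n-cell is mod 2 the
   sum of the n-simplices of its barycentric subdivision. *)
Definition vk_cochain K (lam : cell -> bool) n (p : cell) : 'F_2 :=
  \sum_(f in flags K n p) w1_pow lam f.

(* vk_cochain is invariant under the involution, so that its value on a chain
   of the quotient can be computed on any lift. *)
Definition vk_pairing K (lam : cell -> bool) n (c : chain) : 'F_2 :=
  \sum_(p in ncells K n) (c p)%:~R * vk_cochain K lam n p.

(* The generator of Z/2 acts on the coefficients by - (-1)^n. *)
Definition csign n : int := (-1) ^+ n.+1.

(* c is a lift to the deleted product of a chain of the quotient.  The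
   cohomology class does not depend on the choice of the classifying map. *)
Definition evaluation_cycle K n (c : chain) : Prop :=
  [/\ is_chain K n c,
      coinv_zero K n.-1 (csign n) (boundary K c),
      (exists2 lam, classifying K lam & vk_pairing K lam n c != 0)
    & forall s, s \in simplices K -> sdim s = n ->
        \sum_(v : 'I_m | v \notin s) coef (csign n) c (s, [set v]%SET) = 0].

(* K is an equivariant (n+1)-obstructor. *)
Definition equivariant_obstructor (H : finGroupType) K (a : Hcomplex H K) n :
    Prop :=
  exists2 c : chain, evaluation_cycle K n c &
  exists2 A : {set H}, A != finset.set0 /\ (forall h, h \in A -> square_subgroup h) &
    coinv_zero K n (csign n) (\sum_(h in A) push (a h) c).

End Chains.

Section CW.
Context {R : realType}.

Definition I01 : set R := `[0, 1]%classic.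

(* Cells are modelled on the cube [-1, 1]^k, i.e. the unit ball of the sup
   norm. *)
Definition cdisk k : set 'rV[R]_k := [set u | forall i, `|u 0 i| <= 1].
Definition odisk k : set 'rV[R]_k := [set u | forall i, `|u 0 i| < 1].
Arguments cdisk k u : clear implicits.
Arguments odisk k u : clear implicits.

Record cw_structure (E : topologicalType) := CWStructure {
  cw_cell : Type;
  cw_dim : cw_cell -> nat;
  cw_char : forall e : cw_cell, 'rV[R]_(cw_dim e) -> E;
  cw_open := fun e : cw_cell => cw_char (e := e) @` odisk (cw_dim e);
  cw_hausdorff : hausdorff_space E;
  cw_continuous : forall e,
    {within cdisk (cw_dim e), continuous (cw_char (e := e))};
  cw_injective : forall e u v, odisk (cw_dim e) u -> odisk (cw_dim e) v ->
    cw_char u = cw_char v -> u = v;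
  cw_cover : forall x, exists e, cw_open e x;
  cw_disjoint : forall e e' x, cw_open e x -> cw_open e' x -> e = e';
  cw_closure_finite : forall e, exists2 F : set cw_cell, finite_set F &
    (forall e', F e' -> (cw_dim e' < cw_dim e)%N) /\
    cw_char (e := e) @` (cdisk (cw_dim e) `\` odisk (cw_dim e))
      `<=` \bigcup_(e' in F) cw_open e';
  cw_weak : forall A : set E,
    (forall e, closed (cdisk (cw_dim e) `&` cw_char (e := e) @^-1` A)) ->
    closed A
}.

Definition cw_skeleton (E : topologicalType) (X : cw_structure E) (k : nat) :
    set E :=
  \bigcup_(e in [set e : cw_cell X | (cw_dim e <= k)%N]) cw_open e.

Definition cellular_map (E : topologicalType) (X : cw_structure E)
    (f : E -> E) : Prop :=
  continuous f /\ forall k, f @` cw_skeleton X k `<=` cw_skeleton X k.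

Definition contractible (E : topologicalType) : Prop :=
  exists (x0 : E) (F : R * E -> E),
    [/\ {within I01 `*` setT, continuous F},
        forall x, F (0, x) = x & forall x, F (1, x) = x0].

End CW.

(* Models of EG: a contractible CW complex with a proper cocompact cellular
   action of G and a proper G-invariant metric (inducing its topology). *)
Record EG_space (R : realType) (G : groupType) := EGSpace {
  EG_carrier :> metricType R;
  EG_cw : @cw_structure R EG_carrier;
  EG_contractible : @contractible R EG_carrier;
  EG_act : left_action G EG_carrier;
  EG_cellular : forall g, cellular_map EG_cw (EG_act g);
  EG_proper : forall C : set EG_carrier, compact C ->
    finite_set [set g | (EG_act g @` C) `&` C !=set0];
  EG_cocompact : exists2 C : set EG_carrier, compact C &
    \bigcup_(g in [set: G]) (EG_act g @` C) = setT;
  EG_isometric : forall g x y, mdist (EG_act g x) (EG_act g y) = mdist x y;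
  EG_proper_metric : forall (x : EG_carrier) (r : R),
    compact [set y | mdist x y <= r]
}.

Section Cones.
Context {R : realType}.

Definition geo_simplex m (s : {set 'I_m}) : set 'rV[R]_m :=
  [set x | [/\ (forall v, 0 <= x 0 v), \sum_v x 0 v = 1
             & forall v, v \notin s -> x 0 v = 0]].

Definition realization m (K : scomplex m) : set 'rV[R]_m :=
  \bigcup_(s in [set s | s \in simplices K]) geo_simplex s.

(* The point [x, t] of X x [0, oo) / X x 0 is represented by the vector t x;
   ray_from 0 X is the infinite cone on X and, for a simplex X of K,
   ray_from t0 X is the image of X x [t0, oo). *)
Definition ray_from m (t0 : R) (X : set 'rV[R]_m) : set 'rV[R]_m :=
  [set y | exists t x, [/\ t0 <= t, X x & y = t *: x]].

Definition Cone m (K : scomplex m) : set 'rV[R]_m :=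
  ray_from 0 (realization K).

Definition cone_simplex m (s : {set 'I_m}) : set 'rV[R]_m :=
  ray_from 0 (geo_simplex s).

(* Linear extension to the cone of the action on vertices: the basis vector of
   v is sent to that of a h v. *)
Definition cone_act (H : finGroupType) m (K : scomplex m) (a : Hcomplex H K)
    (h : H) (x : 'rV[R]_m) : 'rV[R]_m :=
  \row_v x 0 (a (h^-1)%g v).

Definition proper_on (X Y : topologicalType) (A : set X) (f : X -> Y) : Prop :=
  {within A, continuous f} /\
  forall C : set Y, compact C -> compact (A `&` f @^-1` C).

Definition set_dist (E : metricType R) (A B : set E) : \bar R :=
  ereal_inf [set d | exists x y, [/\ A x, B y & d = (mdist x y)%:E]].

Definition expanding m (K : scomplex m) (E : metricType R)
    (f : 'rV[R]_m -> E) : Prop :=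
  forall s t : {set 'I_m}, s \in simplices K -> t \in simplices K ->
    [disjoint s & t]%B ->
    (set_dist (f @` ray_from r (geo_simplex s))
              (f @` ray_from r (geo_simplex t))) @[r --> +oo%R] --> +oo%E.

Definition nbhd_of (E : metricType R) (r : R) (A : set E) : set E :=
  [set x | exists2 y, A y & mdist x y < r].

Definition H_preserving (G : groupType) (E : EG_space R G)
    (H : finGroupType) m (K : scomplex m) (a : Hcomplex H K)
    (f : 'rV[R]_m -> E) : Prop :=
  forall h : H, exists (g : G) (r : R) (j : R * 'rV[R]_m -> E),
    [/\ square_subgroup h -> square_subgroup g,
        0 < r,
        proper_on (I01 `*` Cone K) j,
        (forall x, Cone K x -> j (0, x) = f (cone_act a h x)) /\
        (forall x, Cone K x -> j (1, x) = EG_act E g (f x))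
      & forall u s, I01 u -> s \in simplices K ->
          (fun x => j (u, x)) @` cone_simplex s `<=`
            nbhd_of r ((fun x => f (cone_act a h x)) @` cone_simplex s)].

End Cones.

(* The supremum ranges over all models E of EG: the existence of f does not
   depend on the model.  It is taken in the extended reals, with value -oo
   when no n qualifies. *)
Definition eqobdim (R : realType) (G : groupType) : \bar R :=
  ereal_sup [set (n + 3)%:R%:E | n in
    [set n | exists (H : finGroupType) (m : nat) (K : scomplex m)
               (a : Hcomplex H K) (E : EG_space R G) (f : 'rV[R]_m -> E),
        [/\ equivariant_obstructor a n, proper_on (Cone K) f,
            expanding K f & H_preserving a f]]].

(* Main.v *)
Require Import Defs.
From HB Require Import structures.
From mathcomp Require Import all_boot all_order all_algebra all_fingroup.
From mathcomp Require Import ring lra zify.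

(** For i = 1, 2 let K_i, with an action of H_i, be an equivariant
    (n_i + 1)-obstructor with an H_i-preserving proper expanding map
    f_i : Cone(K_i) -> EG_i.  The join K of K_1 and K_2, with the action of
    H_1 x H_2, is an equivariant (n_1 + n_2 + 3)-obstructor, and Cone(K) is
    Cone(K_1) x Cone(K_2), so that f_1 x f_2 maps it to EG_1 x EG_2.  Since
    (n_1 + n_2 + 2) + 3 = (n_1 + 3) + (n_2 + 3) - 1, the inequality follows by
    taking suprema.

    That K is an obstructor is seen in the deleted join of K, whose cells are the
    pairs of disjoint simplices of K, possibly empty.  Up to signs its augmented
    chain complex contains the cells of the deleted product, with the involution
    twisted by Z^(-epsilon) becoming the natural swap times the sign of n.  As the
    swap is free, a class of the quotient is determined by its transfer z.  The
    coefficients of the boundary of z at the cells (s, 0), where 0 is the empty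
    simplex, are up to sign the sums over v of the coefficients at (s, v), so that both the cycle condition and the
    condition on these sums in the definition of an evaluation cycle say that z
    is a cycle in the deleted join [coinv_zero_jcycle].  Now the deleted join of K
    is the join of those of K_1 and K_2, hence its chain complex is a tensor
    product.  If c_i is an evaluation cycle of K_i with transfer z_i, then
    z_1 (x) c_2 has the transfer z_1 (x) z_2, which is a cycle [join_jcycle]; and
    the sum of the translates of z_1 (x) z_2 by A_1 x A_2 is the tensor product of
    two sums that vanish.

    For the van Kampen pairing, the powers of w_1 are described by a function u on
    the cells with values in F_2 such that the coboundary of u is u + u o swap
    [alpha_system].  Counting alternating flags gives such a function for which
    u + u o swap is the cochain of the definition [cob_alpha], and the pairing of
    u + u o swap with a cycle of the quotient depends on the value of u at the
    empty cell only [alpha_system_pairing].  The slant product of such a function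
    for K with z_1 is one for K_2, and its value at the empty cell is the pairing
    for K_1.  So the pairing of z_1 (x) c_2 is the product of the two given ones
    [vk_pairing_join], which is 1 in F_2.

    On the geometric side, EG_1 x EG_2 is a model of E(G_1 x G_2) with the maximum
    metric and the product of the cell structures, the cells of which are cubes;
    it has the weak topology because the factors are locally compact [prod_weak].
    Two points on disjoint simplices of K that are far out may be far out in
    different factors, but a point far out on a simplex of K_i is far from the
    whole cone on a disjoint simplex, since f_i is both expanding and proper
    [expanding_one_sided].  *)

Import Order.TTheory GRing.Theory Num.Theory.

Set Implicit Arguments.
Unset Strict Implicit.
Unset Printing Implicit Defensive.

Local Open Scope ring_scope.

(** * The augmented chain complex of the deleted join *)

Definition swap_cell (T : Type) (p : T * T) : T * T := (p.2, p.1).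

Lemma swap_cellK (T : Type) : involutive (@swap_cell T).
Proof. by case. Qed.

Lemma eq_signr (R : pzRingType) (a b : nat) : odd a = odd b -> (-1) ^+ a = (-1) ^+ b :> R.
Proof. by move=> E; rewrite -signr_odd E signr_odd. Qed.

Section DeletedJoin.
Context {R : comNzRingType} {m : nat}.
Implicit Types (x y : cell (m := m) -> R) (p q : cell (m := m)) (s t : {set 'I_m}).

Definition rank_in (v : 'I_m) s : nat := #|[set w in s | (w < v)%N]|.

(** The boundary of the augmented chain complex of the deleted join, whose cell
    p is the join of p.1 and p.2, either of which may be empty: the cofaces of p
    are added up, with the sign of the new vertex in the order that puts all of
    p.1 before all of p.2. *)
Definition jbd x p : R :=
  \sum_(v | v \notin p.1) (-1) ^+ rank_in v p.1 * x (v |: p.1, p.2)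
  + (-1) ^+ #|p.1| *
    \sum_(v | v \notin p.2) (-1) ^+ rank_in v p.2 * x (p.1, v |: p.2).

(** The involution on the augmented chain complex: with the degree of a simplex
    shifted to its number of vertices this is the usual sign of a swap, which is
    what makes it commute with the boundary in every degree. *)
Definition jswap x p : R := (-1) ^+ (#|p.1| * #|p.2|) * x (swap_cell p).

(** The transfer of a class of the quotient by the involution twisted by the
    sign of n. *)
Definition jtrace n x p : R := x p + (-1) ^+ n * jswap x p.

Lemma jbd_ext x y : x =1 y -> jbd x =1 jbd y.
Proof.
move=> xy p; rewrite /jbd; congr (_ + _ * _); apply: eq_bigr => v _;
by rewrite xy.
Qed.

Lemma jbdD x y p : jbd (fun q => x q + y q) p = jbd x p + jbd y p.
Proof.
rewrite /jbd; under eq_bigr do rewrite mulrDr.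
under [X in _ + _ * X = _]eq_bigr do rewrite mulrDr.
by rewrite !big_split /=; ring.
Qed.

Lemma jbdZ (a : R) x p : jbd (fun q => a * x q) p = a * jbd x p.
Proof.
rewrite /jbd mulrDr mulrCA; congr (_ + _ * _); rewrite big_distrr/=;
by apply: eq_bigr => v _; rewrite mulrCA.
Qed.

Lemma jswapK x : jswap (jswap x) =1 x.
Proof.
case=> s t; rewrite /jswap/= [(#|t| * _)%N]mulnC mulrA -exprD addnn.
by rewrite -signr_odd odd_double mul1r.
Qed.

Lemma jbd_swap x : jbd (jswap x) =1 jswap (jbd x).
Proof.
case=> s t; rewrite /jswap /jbd/= addrC mulrDr; congr (_ + _).
  rewrite 2!big_distrr/=; apply: eq_bigr => v vt.
  rewrite cardsU1 vt/= mulrCA [RHS]mulrCA; congr (_ * _); rewrite mulrA -exprD.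
  by congr (_ * _); apply: eq_signr; rewrite !(oddD, oddM)/=; do 2 case: odd.
rewrite mulrA -exprD big_distrr/=; apply: eq_bigr => v vt.
rewrite cardsU1 vt/= [RHS]mulrCA; congr (_ * _).
by congr (_ * _); apply: eq_signr; rewrite !(oddD, oddM)/=; do 2 case: odd.
Qed.

Lemma jbd_trace n x p : jbd (jtrace n x) p = jtrace n (jbd x) p.
Proof. by rewrite /jtrace jbdD jbdZ jbd_swap. Qed.

Lemma jswap_trace n x p : jswap (jtrace n x) p = (-1) ^+ n * jtrace n x p.
Proof.
rewrite /jtrace [RHS]mulrDr signrMK {1}/jswap mulrDr addrC mulrCA.
by congr (_ * _ + _); exact: jswapK.
Qed.

End DeletedJoin.

(** * The deleted product inside the deleted join *)

Section Boundary.
Context {m : nat}.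
Implicit Types (c : chain (m := m)) (p q : cell (m := m)) (s t : {set 'I_m}).
Variable K : scomplex m.

Lemma big_setU1_notin (V : nmodType) (v : 'I_m) (F : {set 'I_m} -> V) :
  \sum_(s : {set 'I_m} | v \in s) F s = \sum_(s : {set 'I_m} | v \notin s) F (v |: s).
Proof.
rewrite (reindex_onto (fun s : {set 'I_m} => v |: s) (fun s => s :\ v))/=; last first.
  by move=> s vs; rewrite setD1K.
apply: eq_bigl => s; rewrite setU11/=.
by apply/eqP/idP => [<-|vs]; rewrite ?setD11// setU1K.
Qed.

Lemma sum_incidence (F : {set 'I_m} -> int) t :
  \sum_s F s * incidence s t =
  \sum_(v | v \notin t) (-1) ^+ rank_in v t * F (v |: t).
Proof.
rewrite /incidence; under eq_bigr do rewrite big_distrr/= big_mkcondr/=.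
rewrite (exchange_big_dep xpredT)//= [RHS]big_mkcond/=; apply: eq_bigr => v _.
rewrite big_setU1_notin; case: ifPn => [vt|]; last first.
  by rewrite negbK => vt; rewrite big1// => s vs; case: eqP => // E;
    move: vt; rewrite E setU1K// (negPf vs).
rewrite (bigD1 t)//= setU1K// eqxx big1 ?addr0; last first.
  by move=> s /andP[vs st]; rewrite setU1K// eq_sym (negPf st).
rewrite mulrC; congr (_ ^+ _ * _); rewrite /rank_in; apply: eq_card => w.
by rewrite !inE; case: eqP => //= ->; rewrite ltnn andbF.
Qed.

Lemma boundaryE c p : p \in dcells K -> boundary K c p =
  \sum_(v | v \notin p.1) (-1) ^+ rank_in v p.1 * c (v |: p.1, p.2)
  + (-1) ^+ sdim p.1 *
    \sum_(v | v \notin p.2) (-1) ^+ rank_in v p.2 * c (p.1, v |: p.2).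
Proof.
move=> pK; rewrite ffunE pK; case: p pK => s t _ /=.
under [X in X = _]eq_bigr => q _ do rewrite [_ * (_ + _)]mulrDr.
rewrite big_split/=; congr (_ + _).
  rewrite -(sum_incidence (fun s' => c (s', t))).
  transitivity (\sum_a \sum_b c (a, b) * (incidence a s * (b == t)%:R)).
    by rewrite pair_bigA; apply: eq_bigr => -[].
  apply: eq_bigr => a _; rewrite (bigD1 t)//= eqxx mulr1 big1 ?addr0//.
  by move=> b /negPf ->; rewrite !mulr0.
rewrite -(sum_incidence (fun t' => c (s, t'))).
transitivity (\sum_a \sum_b
    c (a, b) * ((-1) ^+ sdim a * (a == s)%:R * incidence b t)).
  by rewrite pair_bigA; apply: eq_bigr => -[].
rewrite (bigD1 s)//= eqxx [X in _ + X]big1 ?addr0; last first.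
  by move=> a /negPf as_; rewrite big1// => b _; rewrite as_ mulr0 mul0r mulr0.
by rewrite big_distrr/=; apply: eq_bigr => b _; rewrite mulr1 mulrCA.
Qed.

End Boundary.

Section Cells.
Context {m : nat}.
Implicit Types (p q : cell (m := m)) (s t : {set 'I_m}) (c : chain (m := m)).
Variable K : scomplex m.

Definition jcells : {set cell} :=
  [set p : cell | [&& (p.1 == set0) || (p.1 \in simplices K),
     (p.2 == set0) || (p.2 \in simplices K) & [disjoint p.1 & p.2]]].

Lemma simplex_set0F s : s \in simplices K -> (s == set0) = false.
Proof. by move=> sK; apply: contraNF (simplex_neq0 K) => /eqP <-. Qed.

Lemma simplex_card s : s \in simplices K -> #|s| = (sdim s).+1.
Proof.
by move=> /simplex_set0F s0; rewrite /sdim prednK// card_gt0 s0.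
Qed.

Lemma dcellsE p : (p \in dcells K) =
  [&& p \in jcells, p.1 != set0 & p.2 != set0].
Proof.
rewrite !inE; apply/and3P/and3P => [[p1 p2 d]|[/and3P[/orP[/eqP->|p1]]]].
- by rewrite p1 p2 d !orbT !simplex_set0F.
- by rewrite eqxx.
- by move=> /orP[/eqP->|p2]; rewrite ?eqxx// => d _ _.
Qed.

Lemma dcells_swap p : (swap_cell p \in dcells K) = (p \in dcells K).
Proof. by rewrite !inE disjoint_sym andbCA. Qed.

Lemma ncellsE n p :
  (p \in ncells K n) = (p \in dcells K) && (#|p.1| + #|p.2| == n.+2)%N.
Proof.
rewrite inE; case: (boolP (p \in dcells K)) => //=; rewrite inE.
case/and3P => /simplex_card -> /simplex_card -> _.
by rewrite addSnnS addnC -!addSnnS; apply/eqP/eqP; lia.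
Qed.

Lemma ncells_swap n p : (swap_cell p \in ncells K n) = (p \in ncells K n).
Proof. by rewrite !ncellsE dcells_swap addnC. Qed.

Lemma jcells_face p s t : p \in jcells -> s \subset p.1 -> t \subset p.2 ->
  (s, t) \in jcells.
Proof.
have face s1 s2 : (s1 == set0) || (s1 \in simplices K) -> s2 \subset s1 ->
    (s2 == set0) || (s2 \in simplices K).
  case: (eqVneq s2 set0) => //= s2n /orP[/eqP->|s1K ss].
    by rewrite subset0 (negPf s2n).
  exact: simplex_face ss s2n.
rewrite !inE/= => /and3P[p1 p2 d] ss tt.
by rewrite (face _ _ p1 ss) (face _ _ p2 tt) (disjointWl ss) ?(disjointWr tt).
Qed.

Lemma dcells_face p s t : p \in dcells K -> s \subset p.1 -> t \subset p.2 ->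
  s != set0 -> t != set0 -> (s, t) \in dcells K.
Proof.
by rewrite !dcellsE => /and3P[pJ _ _] ss tt -> ->; rewrite (jcells_face pJ).
Qed.

Lemma is_chain_twist n e c : is_chain K n c -> is_chain K n (twist e c).
Proof. by move=> cn p pn; rewrite ffunE cn ?mulr0// (ncells_swap n p). Qed.

Lemma twistK e c : e * e = 1 -> twist e (twist e c) = c.
Proof.
move=> ee; apply/ffunP => -[s t]; rewrite !ffunE/= [(sdim t * _)%N]mulnC.
by rewrite -!mulrA [_ * (e * _)]mulrCA !mulrA ee mul1r -exprD addnn -signr_odd odd_double mul1r.
Qed.

Lemma twistD e c c' : twist e (c + c') = twist e c + twist e c'.
Proof. by apply/ffunP => p; rewrite !ffunE mulrDr. Qed.

(** The involution moves every cell, so that the transfer is injective on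
    coinvariants: the half of c on the cells of which the first factor comes
    first is a preimage of c. *)
Lemma coinv_zeroP n e c : e * e = 1 ->
  coinv_zero K n e c <-> is_chain K n c /\ forall p, coef e c p = 0.
Proof.
move=> ee; split => [[d dn ->]|[cn ce]].
  split=> [p pn|p].
    by have := is_chain_twist e dn pn; rewrite !ffunE => ->; rewrite dn// subr0.
  rewrite /coef; have -> : d - twist e d = d + twist e (- d).
    by congr (_ + _); apply/ffunP => q; rewrite !ffunE mulrN.
  by rewrite twistD twistK// !ffunE; ring.
exists [ffun p : cell => if (enum_rank p.1 < enum_rank p.2)%N then c p else 0].
  by move=> p pn; rewrite ffunE cn ?if_same.
apply/ffunP => -[s t]; rewrite !ffunE/=.
have := ce (s, t); rewrite /coef !ffunE/= => /eqP; rewrite addr_eq0 => /eqP ceq.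
case: ltngtP => [_|_|/ord_inj/enum_rank_inj st]; rewrite ?mulr0 ?subr0 ?sub0r//.
rewrite cn// st ncellsE inE /= -setI_eq0 setIid; apply/negP.
by move=> /andP[/and3P[/simplex_set0F -> ]].
Qed.

End Cells.

Section Conv.
Context {m : nat}.
Implicit Types (p q : cell (m := m)) (s t : {set 'I_m}) (c : chain (m := m)).
Variable K : scomplex m.

(** Chains of the deleted product are chains of the deleted join supported on
    the cells with two nonempty factors.  The two conventions for the sign of
    the boundary of the second factor differ by this change of basis. *)
Definition jconv (x : cell (m := m) -> int) p : int := (-1) ^+ #|p.2| * x p.

Lemma csign_sqr n : csign n * csign n = 1.
Proof. by rewrite /csign -exprD addnn -signr_odd odd_double. Qed.

(** The change of basis turns the twisting by [csign n] into the sign of n in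
    front of the natural involution, in every degree at once. *)
Lemma jtrace_jconv n (x : cell -> int) p : p.1 != set0 -> p.2 != set0 ->
  jtrace n (jconv x) p = (-1) ^+ #|p.2| *
    (x p + csign n * (-1) ^+ (sdim p.1 * sdim p.2) * x (swap_cell p)).
Proof.
rewrite -!card_gt0 /jtrace /jconv /jswap /csign /sdim => p1 p2.
rewrite -(prednK p1) -(prednK p2)/= mulrDr; congr (_ + _); rewrite !mulrA -!exprD.
by congr (_ * _); apply: eq_signr; rewrite !(oddD, oddM, oddS); do 3 case: odd.
Qed.

Lemma jtrace_chain n c : is_chain K n c -> forall p,
  jtrace n (jconv c) p = (-1) ^+ #|p.2| * coef (csign n) c p.
Proof.
move=> cn p; have [/andP[p1 p2]|p0] := boolP ((p.1 != set0) && (p.2 != set0)).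
  by rewrite jtrace_jconv// /coef !ffunE.
have pn : p \notin ncells K n by rewrite ncellsE dcellsE (negPf p0) andbF.
have spn : swap_cell p \notin ncells K n by rewrite ncells_swap.
rewrite /coef !ffunE /jtrace /jswap /jconv.
have -> : c (p.2, p.1) = 0 by exact: cn spn.
by rewrite (cn _ pn) !(mulr0, addr0).
Qed.

Lemma jtrace_chain0 n c p : is_chain K n c -> p \notin ncells K n ->
  jtrace n (jconv c) p = 0.
Proof.
move=> cn pn; rewrite (jtrace_chain cn) /coef ffunE (cn _ pn).
by rewrite (cn (p.2, p.1)) ?mulr0 ?addr0 ?mulr0// (ncells_swap K n p).
Qed.

Lemma jbd_jconv c p : p \in dcells K ->
  jbd (jconv c) p = jconv (boundary K c) p.
Proof.
move=> pK; rewrite /jbd /jconv boundaryE// mulrDr; congr (_ + _).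
  by rewrite big_distrr/=; apply: eq_bigr => v _; rewrite mulrCA.
have -> : (-1) ^+ sdim p.1 = - (-1) ^+ #|p.1| :> int.
  move: pK; rewrite inE => /and3P[/simplex_card -> _ _].
  by rewrite exprS mulN1r opprK.
rewrite mulrCA mulNr -mulrN; congr (_ * _); rewrite -mulrN -sumrN big_distrr/=.
apply: eq_bigr => v vp.
by rewrite cardsU1 vp/= exprS; ring.
Qed.

Lemma ncells_coface n p v : p.1 != set0 -> p.2 != set0 -> p \notin ncells K n.-1 ->
  (v \notin p.1 -> (v |: p.1, p.2) \notin ncells K n) /\
  (v \notin p.2 -> (p.1, v |: p.2) \notin ncells K n).
Proof.
move=> p10 p20; rewrite !ncellsE => pn.
have p1 : (0 < #|p.1|)%N by rewrite card_gt0.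
have p2 : (0 < #|p.2|)%N by rewrite card_gt0.
split=> vp; apply: contra pn => /andP[qK]; rewrite /= cardsU1 vp/= => /eqP qn;
  rewrite (surjective_pairing p) (dcells_face qK)//= ?subsetUr//; apply/eqP;
  move: p1 p2 qn; move: #|p.1| #|p.2| => a b; lia.
Qed.

Lemma boundary_chain n c : is_chain K n c -> is_chain K n.-1 (boundary K c).
Proof.
move=> cn p pn; have [pK|pK] := boolP (p \in dcells K); last first.
  by rewrite ffunE (negPf pK).
have /and3P[_ p10 p20] : [&& p \in jcells K, p.1 != set0 & p.2 != set0].
  by rewrite -dcellsE.
rewrite boundaryE// !big1 ?mulr0 ?addr0// => v vp; rewrite cn ?mulr0//.
  by case: (ncells_coface v p10 p20 pn) => _; apply.
by case: (ncells_coface v p10 p20 pn) => + _; apply.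
Qed.

(** The sum of the coefficients at the cells (s, v) is up to sign the coefficient
    of the boundary of the transfer at the join of s and the empty simplex, a
    face which is lost in the deleted product.  So the two conditions together
    say that the transfer is a cycle of the whole deleted join. *)
Lemma coinv_zero_jcycle n c : is_chain K n c ->
  coinv_zero K n.-1 (csign n) (boundary K c) /\
  (forall s, s \in simplices K -> sdim s = n ->
     \sum_(v : 'I_m | v \notin s) coef (csign n) c (s, [set v]) = 0) <->
  forall p, jbd (jtrace n (jconv c)) p = 0.
Proof.
move=> cn; set Z := jtrace n (jconv c).
have jbdZ_d p : p \in dcells K ->
    jbd Z p = (-1) ^+ #|p.2| * coef (csign n) (boundary K c) p.
  move=> pK; have /and3P[_ p10 p20] : [&& p \in jcells K, p.1 != set0 & p.2 != set0].
    by rewrite -dcellsE.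
  rewrite /Z jbd_trace {1}/jtrace /jswap !jbd_jconv// ?dcells_swap//.
  by rewrite -[LHS]/(jtrace n (jconv (boundary K c)) p) jtrace_jconv// /coef [twist _ _ _]ffunE.
have jbdZ_l s : jbd Z (s, set0) =
    - (-1) ^+ #|s| * \sum_(v | v \notin s) coef (csign n) c (s, [set v]).
  have Z0 s' : Z (s', set0) = 0.
    by rewrite /Z jtrace_chain0// ncellsE dcellsE eqxx !andbF.
  rewrite /jbd/= big1 ?add0r => [|v _]; last by rewrite Z0 mulr0.
  rewrite mulNr -mulrN -sumrN; congr (_ * _).
  rewrite [RHS]big_mkcond/= [LHS]big_mkcond/=; apply: eq_bigr => v _.
  rewrite inE/= setU0 /rank_in; have -> : [set w in (set0 : {set 'I_m}) | (w < v)%N] = set0.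
    by apply/setP => w; rewrite !inE.
  rewrite cards0 mul1r; case: ifPn => [vs|]; last first.
    rewrite negbK => vs; rewrite /Z jtrace_chain0//.
    by rewrite ncellsE inE/= disjoint_sym disjoints1 vs !andbF.
  by rewrite /Z (jtrace_chain cn)/= cards1 expr1 mulN1r.
rewrite coinv_zeroP ?csign_sqr//; split=> [[[_ bd0] sum0] p|Z0].
  have [pK|pK] := boolP (p \in dcells K); first by rewrite jbdZ_d// bd0 mulr0.
  have Zl s : jbd Z (s, set0) = 0.
    rewrite jbdZ_l; case: (boolP ((s \in simplices K) && (sdim s == n))).
      by move=> /andP[sK /eqP sn]; rewrite sum0// mulr0.
    move=> sN; rewrite big1 ?mulr0// => v _.
    have sn : (s, [set v]) \notin ncells K n.
      by apply: contra sN; rewrite !inE/= /sdim cards1 addn0 => /andP[/and3P[-> _ _] ->].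
    by rewrite /coef ffunE !cn ?mulr0 ?addr0// (ncells_swap K n (s, _)).
  have [p2|p20] := eqVneq p.2 set0.
    by rewrite (surjective_pairing p) p2 Zl.
  have [p1|p10] := eqVneq p.1 set0.
    have -> : jbd Z p = (-1) ^+ n * jbd (jswap Z) p.
      by rewrite -jbdZ; apply: jbd_ext => q; rewrite jswap_trace signrMK.
    by rewrite jbd_swap /jswap /swap_cell p1 Zl !mulr0.
  have notK s t : p.1 \subset s -> p.2 \subset t -> Z (s, t) = 0.
    move=> ss tt; rewrite /Z jtrace_chain0// ncellsE.
    apply: contra pK => /andP[qK _]; rewrite (surjective_pairing p).
    by apply: (dcells_face qK).
  by rewrite /jbd !big1 ?mulr0 ?addr0// => v vp; rewrite notK ?mulr0// subsetUr.
split.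
  split=> [|p]; first exact: boundary_chain.
  have [pK|pK] := boolP (p \in dcells K).
    have /eqP := Z0 p; rewrite jbdZ_d// mulf_eq0 expf_eq0 oppr_eq0 oner_eq0 andbF.
    by move=> /= /eqP.
  rewrite /coef !ffunE (negPf pK).
  by rewrite (negPf (_ : (p.2, p.1) \notin dcells K)) ?mulr0// (dcells_swap K p).
move=> s sK sn; have /eqP := Z0 (s, set0).
rewrite jbdZ_l mulf_eq0 oppr_eq0 expf_eq0 oppr_eq0 oner_eq0 andbF.
by move=> /= /eqP.
Qed.

End Conv.

(** * Simplicial actions on chains *)

Section Push.
Context {m : nat}.
Implicit Types (p q : cell (m := m)) (s t : {set 'I_m}) (c : chain (m := m)).

Definition jpush (h : 'I_m -> 'I_m) (x : cell (m := m) -> int) p : int :=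
  \sum_(q : cell | ((h @: q.1)%SET, (h @: q.2)%SET) == p)
     (-1) ^+ (inversions h q.1 + inversions h q.2) * x q.

Lemma jpushE (h g : 'I_m -> 'I_m) x p : cancel h g -> cancel g h ->
  jpush h x p = (-1) ^+ (inversions h (g @: p.1) + inversions h (g @: p.2)) *
    x ((g @: p.1)%SET, (g @: p.2)%SET).
Proof.
move=> hg gh; rewrite /jpush (big_pred1 ((g @: p.1)%SET, (g @: p.2)%SET))//.
have imK (f f' : 'I_m -> 'I_m) s : cancel f f' -> (f' @: (f @: s) = s)%SET.
  by move=> ff; rewrite -imset_comp (eq_imset (g := id)) ?imset_id.
move=> q /=; apply/eqP/eqP => [<-|->]/=; rewrite ?(imK _ _ _ hg) ?(imK _ _ _ gh).
  by case: q.
by case: p.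
Qed.

Lemma pushE (h : 'I_m -> 'I_m) c : push h c =1 jpush h c.
Proof. by move=> p; rewrite ffunE. Qed.

Lemma jpush_ext h x y : x =1 y -> jpush h x =1 jpush h y.
Proof. by move=> xy p; apply: eq_bigr => q _; rewrite xy. Qed.

Variables (H : finGroupType) (K : scomplex m) (a : Hcomplex H K).

Lemma lactK (h : H) : cancel (a h) (a (h^-1)%g).
Proof. by move=> v; rewrite -lactM mulVg lact1. Qed.

Lemma lactVK (h : H) : cancel (a (h^-1)%g) (a h).
Proof. by move=> v; rewrite -lactM mulgV lact1. Qed.

Lemma lact_dcells (h : H) p :
  (((a h @: p.1)%SET, (a h @: p.2)%SET) \in dcells K) = (p \in dcells K).
Proof.
have sub (g : H) q : q \in dcells K -> ((a g @: q.1)%SET, (a g @: q.2)%SET) \in dcells K.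
  rewrite !inE/= => /and3P[q1 q2 d]; rewrite !Hact_simplicial//=.
  rewrite -setI_eq0 -imsetI; last by move=> u v _ _; apply: (can_inj (@lactK g)).
  by move: d; rewrite -setI_eq0 => /eqP ->; rewrite imset0.
apply/idP/idP; last exact: sub.
move=> /(sub (h^-1)%g)/=; rewrite -!imset_comp !(eq_imset (g := id)) ?imset_id//;
  try by move=> v; exact: lactK.
by case: p.
Qed.

Lemma push_chain n c (h : H) : is_chain K n c -> is_chain K n (push (a h) c).
Proof.
move=> cn p pn; rewrite ffunE big1// => q /eqP qp.
rewrite cn ?mulr0//; apply: contra pn; rewrite -qp !inE /sdim /=.
rewrite !(card_imset _ (can_inj (@lactK h))) => /andP[qK ->]; rewrite andbT.
by have := lact_dcells h q; rewrite !inE/= => ->.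
Qed.

Lemma jpush_coef n c (h : H) p : is_chain K n c ->
  jpush (a h) (jtrace n (jconv c)) p =
  (-1) ^+ #|p.2| * coef (csign n) (push (a h) c) p.
Proof.
move=> cn; rewrite -(jtrace_chain (push_chain h cn)) /jtrace /jswap /jconv !pushE.
rewrite !(jpushE _ _ (@lactK h) (@lactVK h))/=.
by rewrite !(card_imset _ (can_inj (@lactVK h))) [(inversions _ (_ @: p.2) + _)%N]addnC; ring.
Qed.

Lemma coinv_zero_push n c (A : {set H}) : is_chain K n c ->
  coinv_zero K n (csign n) (\sum_(h in A) push (a h) c) <->
  forall p, \sum_(h in A) jpush (a h) (jtrace n (jconv c)) p = 0.
Proof.
move=> cn; rewrite coinv_zeroP ?csign_sqr//.
have E p : \sum_(h in A) jpush (a h) (jtrace n (jconv c)) p =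
    (-1) ^+ #|p.2| * coef (csign n) (\sum_(h in A) push (a h) c) p.
  under eq_bigr => h _ do rewrite (jpush_coef _ _ cn).
  rewrite -big_distrr/= /coef; congr (_ * _).
  rewrite ffunE !sum_ffunE big_distrr/= -big_split/=.
  by apply: eq_bigr => h _; rewrite [twist _ _ _]ffunE.
split=> [[_ Z0] p|Z0]; first by rewrite E Z0 mulr0.
split=> [p pn|p]; first by rewrite sum_ffunE big1// => h _; rewrite (push_chain h cn).
have /eqP := Z0 p; rewrite E mulf_eq0 expf_eq0 oppr_eq0 oner_eq0 andbF.
by move=> /= /eqP.
Qed.

End Push.

(** * The deleted join of a join as a tensor product *)

Section JoinSets.
Context {m1 m2 : nat}.
Implicit Types (s t : {set 'I_(m1 + m2)}) (p q : cell (m := m1 + m2)).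

Definition lpart s : {set 'I_m1} := [set i | lshift m2 i \in s].
Definition rpart s : {set 'I_m2} := [set j | rshift m1 j \in s].
Definition usum (s1 : {set 'I_m1}) (s2 : {set 'I_m2}) : {set 'I_(m1 + m2)} :=
  [set i | match split i with inl j => j \in s1 | inr j => j \in s2 end].
Definition lcell p : cell := (lpart p.1, lpart p.2).
Definition rcell p : cell := (rpart p.1, rpart p.2).
Definition ucell (p1 : cell (m := m1)) (p2 : cell (m := m2)) : cell (m := m1 + m2) :=
  (usum p1.1 p2.1, usum p1.2 p2.2).

Lemma split_l (i : 'I_m1) : split (lshift m2 i) = inl i.
Proof. exact: (unsplitK (inl i)). Qed.

Lemma split_r (j : 'I_m2) : split (rshift m1 j) = inr j.
Proof. exact: (unsplitK (inr j)). Qed.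

Lemma ord_sumP (P : 'I_(m1 + m2) -> Prop) :
  (forall i, P (lshift m2 i)) -> (forall j, P (rshift m1 j)) -> forall k, P k.
Proof. by move=> Pl Pr k; case: (split_ordP k) => i ->. Qed.

Lemma lpart_usum (s1 : {set 'I_m1}) (s2 : {set 'I_m2}) : lpart (usum s1 s2) = s1.
Proof. by apply/setP => i; rewrite !inE split_l. Qed.

Lemma rpart_usum (s1 : {set 'I_m1}) (s2 : {set 'I_m2}) : rpart (usum s1 s2) = s2.
Proof. by apply/setP => i; rewrite !inE split_r. Qed.

Lemma usum_parts s : usum (lpart s) (rpart s) = s.
Proof.
by apply/setP; apply: ord_sumP => i; rewrite inE ?split_l ?split_r inE.
Qed.

Lemma lcell_ucell (p1 : cell (m := m1)) (p2 : cell (m := m2)) : lcell (ucell p1 p2) = p1.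
Proof. by rewrite /lcell /= !lpart_usum; case: p1. Qed.

Lemma rcell_ucell (p1 : cell (m := m1)) (p2 : cell (m := m2)) : rcell (ucell p1 p2) = p2.
Proof. by rewrite /rcell /= !rpart_usum; case: p2. Qed.

Lemma ucell_parts p : ucell (lcell p) (rcell p) = p.
Proof. by rewrite /ucell !usum_parts; case: p. Qed.

Lemma card_parts s : #|s| = (#|lpart s| + #|rpart s|)%N.
Proof.
rewrite -!sum1_card big_split_ord/=.
by congr (_ + _)%N; apply: eq_bigl => i; rewrite inE.
Qed.

Lemma lpart_ladd v s : lpart (lshift m2 v |: s) = v |: lpart s.
Proof. by apply/setP => i; rewrite !inE (inj_eq (@lshift_inj _ _)). Qed.

Lemma rpart_ladd v s : rpart (lshift m2 v |: s) = rpart s.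
Proof. by apply/setP => i; rewrite !inE eq_rlshift. Qed.

Lemma lpart_radd v s : lpart (rshift m1 v |: s) = lpart s.
Proof. by apply/setP => i; rewrite !inE eq_lrshift. Qed.

Lemma rpart_radd v s : rpart (rshift m1 v |: s) = v |: rpart s.
Proof. by apply/setP => i; rewrite !inE (inj_eq (@rshift_inj _ _)). Qed.

Lemma lpart_ldel v s : lpart (s :\ lshift m2 v) = lpart s :\ v.
Proof. by apply/setP => i; rewrite !inE (inj_eq (@lshift_inj _ _)). Qed.

Lemma rpart_ldel v s : rpart (s :\ lshift m2 v) = rpart s.
Proof. by apply/setP => i; rewrite !inE eq_rlshift. Qed.

Lemma lpart_rdel v s : lpart (s :\ rshift m1 v) = lpart s.
Proof. by apply/setP => i; rewrite !inE eq_lrshift. Qed.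

Lemma rpart_rdel v s : rpart (s :\ rshift m1 v) = rpart s :\ v.
Proof. by apply/setP => i; rewrite !inE (inj_eq (@rshift_inj _ _)). Qed.

Lemma rank_in_l v s : rank_in (lshift m2 v) s = rank_in v (lpart s).
Proof.
rewrite /rank_in card_parts (_ : rpart _ = set0) ?cards0 ?addn0; last first.
  by apply/setP => i; rewrite !inE /= ltnNge (ltnW _) ?andbF// ltn_addr.
by apply: eq_card => i; rewrite !inE.
Qed.

Lemma rank_in_r v s : rank_in (rshift m1 v) s = (#|lpart s| + rank_in v (rpart s))%N.
Proof.
rewrite /rank_in card_parts; congr (_ + _)%N; apply: eq_card => i; rewrite !inE/=.
  by rewrite ltn_addr ?andbT.
by rewrite ltn_add2l.
Qed.

Lemma disjoint_parts s t :
  [disjoint s & t] = [disjoint lpart s & lpart t] && [disjoint rpart s & rpart t].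
Proof.
rewrite -!setI_eq0 -!cards_eq0 card_parts addn_eq0.
by congr (_ && _); congr (_ == _); apply: eq_card => i; rewrite !inE.
Qed.

Lemma parts_eq0 s : (s == set0) = (lpart s == set0) && (rpart s == set0).
Proof. by rewrite -!cards_eq0 card_parts addn_eq0. Qed.

Section Maps.
Variables (h1 : 'I_m1 -> 'I_m1) (h2 : 'I_m2 -> 'I_m2).

Definition sum_map (k : 'I_(m1 + m2)) : 'I_(m1 + m2) :=
  match split k with inl i => lshift m2 (h1 i) | inr j => rshift m1 (h2 j) end.

Lemma sum_map_l i : sum_map (lshift m2 i) = lshift m2 (h1 i).
Proof. by rewrite /sum_map split_l. Qed.

Lemma sum_map_r j : sum_map (rshift m1 j) = rshift m1 (h2 j).
Proof. by rewrite /sum_map split_r. Qed.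

Lemma lpart_map s : lpart (sum_map @: s) = (h1 @: lpart s)%SET.
Proof.
apply/setP => i; rewrite inE; apply/imsetP/imsetP => [[k]|[j]].
  elim/ord_sumP: k => k ks; rewrite ?sum_map_l ?sum_map_r.
    by move=> /lshift_inj ->; exists k; rewrite ?inE.
  by move=> /eqP; rewrite eq_lrshift.
by rewrite inE => js ->; exists (lshift m2 j); rewrite ?sum_map_l.
Qed.

Lemma rpart_map s : rpart (sum_map @: s) = (h2 @: rpart s)%SET.
Proof.
apply/setP => i; rewrite inE; apply/imsetP/imsetP => [[k]|[j]].
  elim/ord_sumP: k => k ks; rewrite ?sum_map_l ?sum_map_r.
    by move=> /eqP; rewrite eq_rlshift.
  by move=> /rshift_inj ->; exists k; rewrite ?inE.
by rewrite inE => js ->; exists (rshift m1 j); rewrite ?sum_map_r.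
Qed.

Lemma inversions_sum s :
  inversions sum_map s = (inversions h1 (lpart s) + inversions h2 (rpart s))%N.
Proof.
have invE m (h : 'I_m -> 'I_m) (s' : {set 'I_m}) : inversions h s' =
    (\sum_(v in s') \sum_(w in s' | (v < w)%N && (h w < h v)%N) 1)%N.
  rewrite pair_big_dep/= /inversions -sum1_card; apply: eq_bigl => -[v w] /=.
  by rewrite inE.
rewrite !invE [LHS]big_split_ord/=; congr (_ + _)%N.
  apply: eq_big => [i|i _]; first by rewrite inE.
  rewrite big_split_ord/= [X in (_ + X)%N]big1 ?addn0; last first.
    by move=> j /and3P[_ _]; rewrite sum_map_r sum_map_l ltnNge ltnW//= ltn_addr.
  by apply: eq_bigl => j; rewrite inE !sum_map_l.
apply: eq_big => [i|i _]; first by rewrite inE.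
rewrite big_split_ord/= [X in (X + _)%N]big1 ?add0n; last first.
  by move=> j /and3P[_ + _]; rewrite ltnNge ltnW//= ltn_addr.
by apply: eq_bigl => j; rewrite inE !sum_map_r/= !ltn_add2l.
Qed.

End Maps.

Lemma sum_mapK h1 h2 g1 g2 : cancel h1 g1 -> cancel h2 g2 ->
  cancel (sum_map h1 h2) (sum_map g1 g2).
Proof.
by move=> hg1 hg2; apply: ord_sumP => i; rewrite ?(sum_map_l, sum_map_r) ?hg1 ?hg2.
Qed.

End JoinSets.

Section JoinProduct.
Context {R : comNzRingType} {m1 m2 : nat}.
Implicit Types (p : cell (m := m1 + m2)).

(** The tensor product of chains.  A cell of the deleted join of a join is the
    join of s1, s2, t1 and t2 in this order; the sign comes from moving s2 past
    t1. *)
Definition jprod (x1 : cell -> R) (x2 : cell -> R) p : R :=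
  (-1) ^+ (#|rpart p.1| * #|lpart p.2|) * (x1 (lcell p) * x2 (rcell p)).

Lemma jbd_prod x1 x2 p : jbd (jprod x1 x2) p =
  (-1) ^+ (#|rpart p.1| * #|lpart p.2|) *
  (jbd x1 (lcell p) * x2 (rcell p) +
   (-1) ^+ (#|lpart p.1| + #|lpart p.2|) * (x1 (lcell p) * jbd x2 (rcell p))).
Proof.
case: p => s t; rewrite /jbd /lcell /rcell /=.
rewrite !big_split_ord/= card_parts !exprD.
have notin_l v (s' : {set 'I_(m1 + m2)}) :
    (lshift m2 v \notin s') = (v \notin lpart s') by rewrite inE.
have notin_r v (s' : {set 'I_(m1 + m2)}) :
    (rshift m1 v \notin s') = (v \notin rpart s') by rewrite inE.
have sqr_sgn (k : nat) : (-1) ^+ k * (-1) ^+ k = 1 :> R.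
  by rewrite -expr2 sqrr_sign.
set ss := (-1) ^+ (_ * _); set sls := (-1) ^+ #|lpart s|.
set srs := (-1) ^+ #|rpart s|; set slt := (-1) ^+ #|lpart t|.
set X1 := x1 _; set X2 := x2 _.
set S1 := \sum_(v | v \notin lpart s) _; set S2 := \sum_(v | v \notin rpart s) _.
set S3 := \sum_(v | v \notin lpart t) _; set S4 := \sum_(v | v \notin rpart t) _.
set T1 := \sum_(v | lshift m2 v \notin s) _.
set T2 := \sum_(v | rshift m1 v \notin s) _.
set T3 := \sum_(v | lshift m2 v \notin t) _.
set T4 := \sum_(v | rshift m1 v \notin t) _.
have -> : T1 = ss * X2 * S1.
  rewrite big_distrr; apply: eq_big => [v|v _]; rewrite ?notin_l//.
  by rewrite /jprod /lcell /rcell /= lpart_ladd rpart_ladd rank_in_l /ss /X2; ring.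
have -> : T2 = ss * sls * slt * X1 * S2.
  rewrite big_distrr; apply: eq_big => [v|v]; rewrite notin_r// => vs.
  rewrite /jprod /lcell /rcell /= lpart_radd rpart_radd rank_in_r cardsU1 vs/=.
  by rewrite mulSn !exprD /ss /sls /slt /X1; ring.
have -> : T3 = srs * ss * X2 * S3.
  rewrite big_distrr; apply: eq_big => [v|v]; rewrite notin_l// => vt.
  rewrite /jprod /lcell /rcell /= lpart_ladd rpart_ladd rank_in_l cardsU1 vt/=.
  by rewrite mulnS !exprD /ss /srs /X2; ring.
have -> : T4 = ss * slt * X1 * S4.
  rewrite big_distrr; apply: eq_big => [v|v _]; rewrite ?notin_r//.
  rewrite /jprod /lcell /rcell /= lpart_radd rpart_radd rank_in_r.
  by rewrite !exprD /ss /slt /X1; ring.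
have E : srs * srs = 1 by exact: sqr_sgn.
(* The sign of |rpart s| occurs twice in the terms of S3. *)
transitivity (ss * X2 * S1 + ss * sls * slt * X1 * S2 +
  (srs * srs) * sls * ss * X2 * S3 + sls * srs * ss * slt * X1 * S4); first by ring.
by rewrite E; ring.
Qed.

Lemma jswap_prod x1 x2 p : jswap (jprod x1 x2) p = jprod (jswap x1) (jswap x2) p.
Proof.
case: p => s t; rewrite /jswap /jprod /swap_cell /lcell /rcell /=.
rewrite (card_parts s) (card_parts t) !mulnDl !mulnDr !exprD.
have E := sqrr_sign R (#|lpart s| * #|rpart t|); rewrite expr2 in E.
rewrite [(#|rpart t| * #|lpart s|)%N]mulnC.
set a := (-1) ^+ (#|lpart s| * #|rpart t|) in E *.
set X1 := x1 _; set X2 := x2 _.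
transitivity ((a * a) * ((-1) ^+ (#|lpart s| * #|lpart t|) *
  (-1) ^+ (#|rpart s| * #|lpart t|) * (-1) ^+ (#|rpart s| * #|rpart t|)) * X1 * X2).
  by ring.
by rewrite E; ring.
Qed.

(** If the first factor is already invariant, the transfer acts on the second
    factor only. *)
Lemma jtrace_prod n1 n2 x1 x2 p : jswap x1 =1 (fun q => (-1) ^+ n1 * x1 q) ->
  jtrace (n1 + n2) (jprod x1 x2) p = jprod x1 (jtrace n2 x2) p.
Proof.
move=> x1s; rewrite /jtrace jswap_prod /jprod x1s exprD.
have E := sqrr_sign R n1; rewrite expr2 in E.
set a := (-1) ^+ n1 in E *.
transitivity ((-1) ^+ (#|rpart p.1| * #|lpart p.2|) * x1 (lcell p) *
  (x2 (rcell p) + (a * a) * (-1) ^+ n2 * jswap x2 (rcell p))); first by ring.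
by rewrite E; ring.
Qed.

End JoinProduct.

Lemma jpush_prod (m1 m2 : nat) (h1 g1 : 'I_m1 -> 'I_m1) (h2 g2 : 'I_m2 -> 'I_m2)
    (x1 x2 : cell -> int) (p : cell) :
  cancel h1 g1 -> cancel g1 h1 -> cancel h2 g2 -> cancel g2 h2 ->
  jpush (sum_map h1 h2) (jprod x1 x2) p = jprod (jpush h1 x1) (jpush h2 x2) p.
Proof.
move=> hg1 gh1 hg2 gh2.
rewrite (jpushE _ _ (sum_mapK hg1 hg2) (sum_mapK gh1 gh2)) /jprod /lcell /rcell /=.
rewrite (jpushE _ _ hg1 gh1) (jpushE _ _ hg2 gh2)/=.
rewrite !lpart_map !rpart_map !inversions_sum !lpart_map !rpart_map.
rewrite (card_imset _ (can_inj gh1)) (card_imset _ (can_inj gh2)).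
by rewrite !exprD; ring.
Qed.

(** * Equivariant cochains modulo 2 *)

Section Mod2.
Context {m : nat}.
Implicit Types (p q : cell (m := m)) (s t : {set 'I_m}) (u : cell (m := m) -> 'F_2).

Lemma addrr_F2 (x : 'F_2) : x + x = 0.
Proof. by case: x => [[|[|//]] x2]; apply: val_inj. Qed.

Lemma oppr_F2 (x : 'F_2) : - x = x.
Proof. by apply/eqP; rewrite eq_sym -addr_eq0 addrr_F2. Qed.

Lemma sign_F2 k : (-1) ^+ k = 1 :> 'F_2.
Proof. by rewrite oppr_F2 expr1n. Qed.

Lemma eq_F2 (x y : 'F_2) : x + y = 0 -> x = y.
Proof. by move=> /eqP; rewrite addr_eq0 oppr_F2 => /eqP. Qed.

Definition cob u p : 'F_2 :=
  \sum_(v in p.1) u (p.1 :\ v, p.2) + \sum_(v in p.2) u (p.1, p.2 :\ v).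

Lemma cobD u u' p : cob (fun q => u q + u' q) p = cob u p + cob u' p.
Proof. by rewrite /cob !big_split /=; ring. Qed.

Lemma cobZ (a : 'F_2) u p : cob (fun q => a * u q) p = a * cob u p.
Proof. by rewrite /cob -!big_distrr /= mulrDr. Qed.

Lemma sum_sym_F2 (I : finType) (A : {set I}) (f : I -> I -> 'F_2) :
  (forall v w, f v w = f w v) -> \sum_(v in A) \sum_(w in A :\ v) f v w = 0.
Proof.
(* The pairs with v before w cancel those with w before v. *)
move=> fC; pose r := [rel v w : I | (enum_rank v < enum_rank w)%N].
have -> : \sum_(v in A) \sum_(w in A :\ v) f v w =
    \sum_(v in A) \sum_(w in A | r v w) f v w + \sum_(v in A) \sum_(w in A | r w v) f v w.
  rewrite -big_split/=; apply: eq_bigr => v vA.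
  rewrite (bigID (r v))/=; congr (_ + _); apply: eq_bigl => w; rewrite !inE.
    by case: (eqVneq w v) => [->|]; rewrite ?ltnn ?andbF.
  rewrite -leqNgt leq_eqVlt; case: (eqVneq w v) => [->|wv]/=.
    by rewrite ltnn andbF.
  by rewrite (negPf (_ : nat_of_ord (enum_rank w) != enum_rank v))//;
    apply: contra wv => /eqP/val_inj/enum_rank_inj ->.
rewrite [X in _ + X](exchange_big_dep (mem A))/=; last by move=> ? ? _ /andP[].
rewrite [X in _ + X](eq_bigr (fun w => \sum_(v in A | r w v) f w v)) ?addrr_F2//.
by move=> w wA; apply: eq_big => [v|v _]; [rewrite wA | exact: fC].
Qed.

Lemma cob_cob u p : cob (cob u) p = 0.
Proof.
case: p => s t; rewrite /cob/= !big_split/=.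
rewrite sum_sym_F2 ?add0r; last first.
  by move=> v w; congr (u (_, _)); apply/setP => x; rewrite !inE andbCA.
rewrite [X in _ + (_ + X)]sum_sym_F2 ?addr0; last first.
  by move=> v w; congr (u (_, _)); apply/setP => x; rewrite !inE andbCA.
by rewrite exchange_big/= addrr_F2.
Qed.

Lemma jbd_cob (z : cell -> 'F_2) u :
  \sum_p z p * cob u p = \sum_p jbd z p * u p.
Proof.
pose G1 s t v := z (v |: s, t) * u (s, t).
pose G2 s t v := z (s, v |: t) * u (s, t).
have -> : \sum_p z p * cob u p =
    \sum_(s : {set 'I_m}) \sum_(t : {set 'I_m}) \sum_(v | v \notin s) G1 s t v +
    \sum_(s : {set 'I_m}) \sum_(t : {set 'I_m}) \sum_(v | v \notin t) G2 s t v.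
  transitivity (\sum_(s : {set 'I_m}) \sum_(t : {set 'I_m}) z (s, t) * cob u (s, t)).
    by rewrite pair_bigA; apply: eq_bigr => -[].
  rewrite /cob; under eq_bigr do under eq_bigr do rewrite mulrDr !big_distrr/=.
  under eq_bigr do rewrite big_split/=; rewrite big_split/=; congr (_ + _).
    rewrite exchange_big [RHS]exchange_big/=; apply: eq_bigr => t _.
    rewrite (exchange_big_dep xpredT)//= [RHS](exchange_big_dep xpredT)//=.
    apply: eq_bigr => v _; rewrite big_setU1_notin; apply: eq_bigr => s vs.
    by rewrite /G1 setU1K.
  apply: eq_bigr => s _.
  rewrite (exchange_big_dep xpredT)//= [RHS](exchange_big_dep xpredT)//=.
  apply: eq_bigr => v _; rewrite big_setU1_notin; apply: eq_bigr => t vt.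
  by rewrite /G2 setU1K.
transitivity (\sum_(s : {set 'I_m}) \sum_(t : {set 'I_m}) jbd z (s, t) * u (s, t));
  last by rewrite pair_bigA; apply: eq_bigr => -[].
rewrite -big_split/=; apply: eq_bigr => s _; rewrite -big_split/=; apply: eq_bigr => t _.
rewrite /jbd/= sign_F2 mul1r mulrDl !big_distrl/=.
by congr (_ + _); apply: eq_bigr => v _; rewrite sign_F2 mul1r.
Qed.

(** By duality from the fact that two vertices can be removed in two orders. *)
Lemma jbd_jbd_F2 (z : cell -> 'F_2) p : jbd (jbd z) p = 0.
Proof.
(* Test against the indicator function of p. *)
transitivity (\sum_q jbd (jbd z) q * (q == p)%:R).
  by rewrite (bigD1 p)//= eqxx mulr1 big1 ?addr0// => q /negPf ->; rewrite mulr0.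
by rewrite -!jbd_cob big1// => q _; rewrite cob_cob mulr0.
Qed.

Lemma jbd_swap_F2 (z : cell -> 'F_2) p :
  jbd (fun q => z (swap_cell q)) p = jbd z (swap_cell p).
Proof.
have E (x : cell -> 'F_2) : jswap x =1 (fun q => x (swap_cell q)).
  by move=> q; rewrite /jswap sign_F2 mul1r.
by rewrite -(jbd_ext (E z)) jbd_swap E.
Qed.

Lemma setU1_neq0 (v : 'I_m) s : v |: s != set0.
Proof. by apply/set0Pn; exists v; rewrite setU11. Qed.

Lemma jbd_off0 (z z' : cell -> 'F_2) p : (forall q, q != (set0, set0) -> z q = z' q) ->
  jbd z p = jbd z' p.
Proof.
move=> zz; rewrite /jbd; congr (_ + _ * _); apply: eq_bigr => v _;
by rewrite zz// xpair_eqE negb_and setU1_neq0 ?orbT.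
Qed.

Lemma sum_swap (F : cell (m := m) -> 'F_2) : \sum_p F (swap_cell p) = \sum_p F p.
Proof. by rewrite [RHS](reindex_inj (inv_inj (@swap_cellK {set 'I_m}))). Qed.

Variable K : scomplex m.

(** In each degree u is one component of an equivariant chain map to the
    resolution of F_2 by copies of F_2[Z/2], and [u p + u (swap_cell p)] is the
    pullback of the generator of the cohomology of Z/2.  One function on cells
    serves for all degrees because a cell determines its degree. *)
Definition alpha_system u : Prop := forall p, p \in jcells K ->
  p != (set0, set0) -> cob u p = u p + u (swap_cell p).

Lemma jcells_diag p : p \in jcells K -> p.1 = p.2 -> p = (set0, set0).
Proof.
case: p => s t /=; rewrite !inE/= => /and3P[_ _ +] st; rewrite -st -setI_eq0 setIid.
by move=> /eqP ->.
Qed.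

(** Two equivariant chain maps to the resolution that agree in the lowest degree
    induce the same map on homology; u is their difference.  The pairing of z
    with the pulled back class is that of the boundary of z with u; this boundary
    is invariant, hence of the form d + swap d up to the empty cell, and pairing it
    with u is pairing d with the pulled back class one degree lower. *)
Lemma alpha_system_pairing0 u (z : cell -> 'F_2) :
  alpha_system u -> u (set0, set0) = 0 ->
  (forall p, p \notin jcells K -> z p = 0) -> z (set0, set0) = 0 ->
  (forall p, jbd (fun q => z q + z (swap_cell q)) p = 0) ->
  \sum_p z p * (u p + u (swap_cell p)) = 0.
Proof.
move=> us u0.
have [N] : exists N, forall p, z p != 0 -> (#|p.1| + #|p.2| <= N)%N.
  by exists (m + m)%N => p _; rewrite leq_add// -[X in (_ <= X)%N]card_ord max_card.
elim: N z => [|N IH] z zN zJ z0 zc.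
  rewrite big1// => p _; have [->|/zN] := eqVneq (z p) 0; first by rewrite mul0r.
  rewrite leqn0 addn_eq0 !cards_eq0 => /andP[/eqP p1 /eqP p2].
  by rewrite (surjective_pairing p) p1 p2 z0 mul0r.
pose b := jbd z.
have bS p : b (swap_cell p) = b p.
  by apply/esym/eq_F2; rewrite /b -jbd_swap_F2 -jbdD zc.
have bN p : b p != 0 -> (p \in jcells K) /\ (#|p.1| + #|p.2| <= N)%N.
  move=> bp; have /existsP[q /and4P[q0 qp1 qp2 /eqP qc]] : [exists q,
      [&& z q != 0%R, p.1 \subset q.1, p.2 \subset q.2
        & (#|p.1| + #|p.2|).+1 == #|q.1| + #|q.2|]%N].
    apply: contraT; rewrite negb_exists => /forallP nq.
    move: bp; rewrite /b /jbd !big1 ?mulr0 ?addr0 ?eqxx//.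
      move=> v vp; apply/eqP; rewrite sign_F2 mul1r; apply: contraNT (nq (p.1, v |: p.2)).
      by move=> zq; rewrite zq /= subsetUr subxx cardsU1 vp addnCA eqxx.
    move=> v vp; apply/eqP; rewrite sign_F2 mul1r; apply: contraNT (nq (v |: p.1, p.2)).
    by move=> zq; rewrite zq /= subsetUr subxx cardsU1 vp eqxx.
  split; last by have := zN _ q0; rewrite -qc ltnS.
  rewrite (surjective_pairing p); apply: (jcells_face _ qp1 qp2).
  by apply: contraT => /zJ; move/eqP: q0.
(* d is the part of b on one cell of each orbit of the swap. *)
pose half p := (enum_rank p.1 < enum_rank p.2)%N.
pose d p := if half p then b p else 0.
have d0 : d (set0, set0) = 0 by rewrite /d /half ltnn.
have dS p : p != (set0, set0) -> d p + d (swap_cell p) = b p.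
  move=> p0; rewrite /d bS /half /=.
  case: ltngtP => [_|_|/ord_inj/enum_rank_inj p12]; rewrite ?addr0 ?add0r//.
  by have [->//|/bN[/jcells_diag/(_ p12)/eqP]] := eqVneq (b p) 0; rewrite (negPf p0).
have -> : \sum_p z p * (u p + u (swap_cell p)) = \sum_p d p * (u p + u (swap_cell p)).
  transitivity (\sum_p b p * u p).
    rewrite /b -jbd_cob; apply: eq_bigr => p _.
    have [->|p0] := eqVneq p (set0, set0); first by rewrite z0 !mul0r.
    have [pJ|pJ] := boolP (p \in jcells K); last by rewrite zJ// !mul0r.
    by rewrite us.
  under [RHS]eq_bigr do rewrite mulrDr.
  rewrite big_split/= -[X in _ = _ + X]sum_swap -big_split/=.
  apply: eq_bigr => p _; rewrite swap_cellK -mulrDl.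
  by have [->|p0] := eqVneq p (set0, set0); rewrite ?u0 ?mulr0// dS.
apply: IH => //.
- by move=> p; rewrite /d; case: ifP => // _ /bN[].
- move=> p pJ; rewrite /d; case: ifP => // _; apply/eqP; apply: contraNT pJ.
  by move=> /bN[].
- move=> p; rewrite (jbd_off0 (z' := b)); first exact: jbd_jbd_F2.
  by move=> q q0; exact: dS.
Qed.

End Mod2.

(** * Counting alternating flags *)

Section Flags.
Context {m : nat}.
Implicit Types (p q : cell (m := m)) (s t : {set 'I_m}).
Variables (K : scomplex m) (lam : cell (m := m) -> bool).

Lemma proper_face_trans : transitive (@proper_face m).
Proof.
move=> q p r /and3P[pq p1 p2] /and3P[qr q1 q2]; apply/and3P; split.
- apply: contraNneq pq => pr; rewrite -pr in q1 q2.
  case: p q p1 p2 q1 q2 {qr pr} => s t [s' t'] /= ss tt ss' tt'.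
  by rewrite xpair_eqE !eqEsubset ss tt ss' tt'.
- exact: subset_trans p1 q1.
- exact: subset_trans p2 q2.
Qed.

Lemma vk_cochain0 p : p \in dcells K -> vk_cochain K lam 0 p = 1.
Proof.
move=> pK; rewrite /vk_cochain (big_pred1 [ffun=> p]).
  by rewrite /w1_pow big_ord0.
move=> f; rewrite inE /=; apply/and3P/eqP => [[/eqP fp _ _]|->].
  by apply/ffunP => i; rewrite ffunE (ord1 i) -fp; congr (f _); apply: val_inj.
split; first by rewrite ffunE.
- by apply/forallP => i; rewrite ffunE.
- by apply/forallP => i; apply/forallP => j; rewrite !(ord1 i) !(ord1 j).
Qed.

Definition flag_rcons n (p : cell (m := m)) (g : {ffun 'I_n.+1 -> cell (m := m)}) :
    {ffun 'I_n.+2 -> cell (m := m)} :=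
  [ffun i => oapp g p (unlift ord_max i)].

Definition flag_belast n (f : {ffun 'I_n.+2 -> cell (m := m)}) :
    {ffun 'I_n.+1 -> cell (m := m)} :=
  [ffun i => f (lift ord_max i)].

Lemma flag_rconsK n p : cancel (@flag_rcons n p) (@flag_belast n).
Proof. by move=> g; apply/ffunP => i; rewrite !ffunE liftK. Qed.

Lemma flag_rcons_max n p (g : {ffun 'I_n.+1 -> cell}) : flag_rcons p g ord_max = p.
Proof. by rewrite ffunE unlift_none. Qed.

Lemma flag_rcons_lift n p (g : {ffun 'I_n.+1 -> cell}) i :
  flag_rcons p g (lift ord_max i) = g i.
Proof. by rewrite ffunE liftK. Qed.

Lemma flag_belastK n (f : {ffun 'I_n.+2 -> cell}) :
  flag_rcons (f ord_max) (flag_belast f) = f.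
Proof.
apply/ffunP => i; rewrite ffunE; case: unliftP => [j|] -> //=.
by rewrite ffunE.
Qed.

Lemma ord_liftP n (P : 'I_n.+2 -> Prop) :
  (forall i : 'I_n.+1, P (lift ord_max i)) -> P ord_max -> forall i, P i.
Proof. by move=> Pl Pm i; case: (unliftP ord_max i) => [j|] ->. Qed.

Lemma flag_rcons_flags n p (g : {ffun 'I_n.+1 -> cell}) : p \in dcells K ->
  (flag_rcons p g \in flags K n.+1 p) =
  (g \in flags K n (g ord_max)) && proper_face (g ord_max) p.
Proof.
move=> pK; rewrite !inE flag_rcons_max !eqxx/=.
apply/andP/andP => [[/forallP fK /forallP fp]|[/andP[/forallP gK /forallP gp] gpf]].
  have fpE (i j : 'I_n.+2) : (i < j)%N -> proper_face (flag_rcons p g i) (flag_rcons p g j).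
    by move=> ij; have /forallP/(_ j)/implyP/(_ ij) := fp i.
  split; last first.
    by have := fpE (lift ord_max ord_max) ord_max; rewrite flag_rcons_lift
      flag_rcons_max; apply; rewrite lift_max /=.
  apply/andP; split; apply/forallP => i.
    by have := fK (lift ord_max i); rewrite flag_rcons_lift.
  apply/forallP => j; apply/implyP => ij.
  by have := fpE (lift ord_max i) (lift ord_max j); rewrite !flag_rcons_lift;
    apply; rewrite !lift_max.
have gpE (i j : 'I_n.+1) : (i < j)%N -> proper_face (g i) (g j).
  by move=> ij; have /forallP/(_ j)/implyP/(_ ij) := gp i.
split; apply/forallP; elim/ord_liftP => [i|]; rewrite ?flag_rcons_lift ?flag_rcons_max//.
  apply/forallP; elim/ord_liftP => [j|]; rewrite ?flag_rcons_lift ?flag_rcons_max; apply/implyP.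
    by rewrite !lift_max; exact: gpE.
  move=> _; have [->//|im] := eqVneq i ord_max.
  apply: proper_face_trans gpf; apply: gpE.
  by rewrite ltn_neqAle im -ltnS ltn_ord.
apply/forallP => j; apply/implyP => /=; rewrite ltnNge.
by move: (ltn_ord j); rewrite ltnS => ->.
Qed.

Lemma w1_pow_rcons n p (g : {ffun 'I_n.+1 -> cell}) :
  w1_pow lam (flag_rcons p g) = w1_pow lam g * w1 lam (g ord_max) p.
Proof.
have liftE (i : nat) : (i < n.+1)%N -> inord i = lift ord_max (inord i : 'I_n.+1) :> 'I_n.+2.
  by move=> i_n; apply: ord_inj; rewrite lift_max !inordK// ltnW.
have maxE k : inord k = ord_max :> 'I_k.+1 by apply: val_inj; rewrite /= inordK.
rewrite /w1_pow big_ord_recr/=; congr (_ * _); last first.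
  by rewrite maxE flag_rcons_max liftE// flag_rcons_lift maxE.
apply: eq_bigr => i _; have i_n : (i.+1 < n.+1)%N by rewrite ltnS ltn_ord.
by rewrite (liftE _ (ltnW i_n)) (liftE _ i_n) !flag_rcons_lift.
Qed.

(** Remove the top of a flag. *)
Lemma vk_cochainS n p : p \in dcells K -> vk_cochain K lam n.+1 p =
  \sum_(q in dcells K | proper_face q p) w1 lam q p * vk_cochain K lam n q.
Proof.
move=> pK; rewrite /vk_cochain.
rewrite (reindex_onto (@flag_rcons n p) (@flag_belast n)) => [|f]; last first.
  by rewrite inE => /andP[/eqP fp _]; rewrite -[RHS]flag_belastK fp.
under eq_bigl do rewrite flag_rconsK eqxx andbT flag_rcons_flags//.
under [RHS]eq_bigr do rewrite big_distrr/=.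
rewrite (partition_big (fun g : {ffun 'I_n.+1 -> cell} => g ord_max)
  (fun q => (q \in dcells K) && proper_face q p))/=; last first.
  by move=> g; rewrite inE => /andP[/and3P[_ /forallP gK _] ->]; rewrite gK.
apply: eq_bigr => q /andP[qK qp]; apply: eq_big => g.
  apply/andP/idP => [[/andP[gf _] /eqP <-//]|gf].
  by move: (gf); rewrite inE => /andP[/eqP -> _]; rewrite gf qp.
by move=> /andP[_ /eqP <-]; rewrite w1_pow_rcons mulrC.
Qed.

Definition cdim p : nat := (sdim p.1 + sdim p.2)%N.

(** Summation over the facets in the deleted product, that is, without the facets
    that have an empty factor. *)
Definition face_sum (F : cell (m := m) -> 'F_2) p : 'F_2 :=
  \sum_(v in p.1) (if p.1 :\ v != set0 then F (p.1 :\ v, p.2) else 0) +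
  \sum_(v in p.2) (if p.2 :\ v != set0 then F (p.1, p.2 :\ v) else 0).

Lemma cdim_dcells p : p \in dcells K -> (#|p.1| + #|p.2| = (cdim p).+2)%N.
Proof. by rewrite inE => /and3P[/simplex_card -> /simplex_card -> _]; rewrite addSn addnS. Qed.

Lemma cdim_proper_face p q : p \in dcells K -> q \in dcells K ->
  proper_face q p -> (cdim q < cdim p)%N.
Proof.
move=> /cdim_dcells pc /cdim_dcells qc /and3P[qp q1 q2].
rewrite -2!ltnS -pc -qc ltn_neqAle leq_add ?subset_leq_card// andbT.
apply: contraNneq qp => E; have := subset_leq_card q1; have := subset_leq_card q2.
move=> c2 c1; rewrite (surjective_pairing p) (surjective_pairing q) xpair_eqE.
rewrite !eqEcard q1 q2 /=; apply/andP; split.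
  by rewrite -(leq_add2r #|q.2|) E leq_add2l.
by rewrite -(leq_add2l #|q.1|) E leq_add2r.
Qed.

Lemma vk_cochain_dim n p : p \in dcells K -> vk_cochain K lam n p != 0 -> (n <= cdim p)%N.
Proof.
elim: n p => [//|n IH] p pK; rewrite vk_cochainS// => nz.
have /existsP[q /and3P[qK qp qn]] : [exists q, [&& q \in dcells K, proper_face q p
    & vk_cochain K lam n q != 0]].
  apply: contraT; rewrite negb_exists => /forallP nq; move: nz.
  rewrite big1 ?eqxx// => q /andP[qK qp].
  by have := nq q; rewrite qK qp/= negbK => /eqP ->; rewrite mulr0.
exact: leq_ltn_trans (IH _ qK qn) (cdim_proper_face pK qK qp).
Qed.

Lemma sum_setD1 (s : {set 'I_m}) (F : {set 'I_m} -> 'F_2) :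
  \sum_(s' : {set 'I_m} | (s' \subset s) && (#|s'|.+1 == #|s|)) F s' = \sum_(v in s) F (s :\ v).
Proof.
rewrite [RHS](partition_big (fun v => s :\ v)
  (fun s' => (s' \subset s) && (#|s'|.+1 == #|s|)))/=; last first.
  by move=> v vs; rewrite subD1set [#|s|](cardsD1 v) vs eqxx.
apply: eq_bigr => s' /andP[ss /eqP sc].
have /cards1P[v vE] : #|s :\: s'| == 1%N.
  by rewrite cardsD (setIidPr ss) -sc subSn// subnn.
have vs : v \in s :\: s' by rewrite vE set11.
have svE : s :\ v = s'.
  apply/setP => w; rewrite !inE; have : (w \in s :\: s') = (w == v) by rewrite vE inE.
  rewrite inE; have := subsetP ss w.
  by case: (w \in s'); case: (w \in s); case: (w == v) => //= /(_ isT).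
rewrite (big_pred1 v) ?svE// => w /=.
apply/andP/eqP => [[ws /eqP E]|->]; last first.
  by split; [move: vs; rewrite inE => /andP[] | rewrite svE].
by apply/eqP; rewrite -in_set1 -vE inE ws -E !inE eqxx.
Qed.

Lemma facetE n p q : p \in dcells K -> cdim p = n.+1 ->
  (q \in dcells K) && (proper_face q p && (cdim q == n)) =
  [&& q.1 \subset p.1, q.2 \subset p.2, q.1 != set0, q.2 != set0 &
    (#|q.1| + #|q.2|).+1 == #|p.1| + #|p.2|]%N.
Proof.
move=> pK pn; have pc := cdim_dcells pK; rewrite pn in pc.
apply/and3P/and5P => [[qK /and3P[_ q1 q2] /eqP qn]|[q1 q2 q10 q20 /eqP qc]].
  have qc := cdim_dcells qK; rewrite qn in qc.
  by move: qK; rewrite dcellsE => /and3P[_ -> ->]; rewrite q1 q2 qc pc eqxx.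
have qK : q \in dcells K by rewrite (surjective_pairing q) (dcells_face pK).
rewrite qK /proper_face q1 q2 !andbT; split=> //.
  by apply/eqP => E; move/eqP: qc; rewrite E eqn_leq ltnn.
by move: qc; rewrite (cdim_dcells qK) pc => -[->].
Qed.

Lemma sum_facets n (F : cell -> 'F_2) p : p \in dcells K -> cdim p = n.+1 ->
  \sum_(q in dcells K | proper_face q p && (cdim q == n)) F q = face_sum F p.
Proof.
move=> pK pn; rewrite (eq_bigl _ _ (fun q => facetE q pK pn)).
have [p10 p20] : p.1 != set0 /\ p.2 != set0.
  by move: pK; rewrite dcellsE => /and3P[].
(* A facet of p has the same second factor as p or the same first factor. *)
rewrite (bigID (fun q : cell => q.2 == p.2))/=; congr (_ + _).
  rewrite -(sum_setD1 p.1 (fun s => if s != set0 then F (s, p.2) else 0)).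
  rewrite (reindex_onto (fun s : {set 'I_m} => (s, p.2)) fst)/=; last first.
    by move=> q /andP[_ /eqP <-]; case: q.
  rewrite -big_mkcondr; apply: eq_bigl => s; rewrite !eqxx !andbT subxx p20/=.
  by rewrite -addSn eqn_add2r -andbA [(_ != _) && _]andbC.
rewrite -(sum_setD1 p.2 (fun s => if s != set0 then F (p.1, s) else 0)).
transitivity (\sum_(q : cell | [&& q.2 \subset p.2, q.2 != set0,
    #|q.2|.+1 == #|p.2| & q.1 == p.1]%N) F q).
  apply: eq_bigl => q; apply/andP/and4P => [[/and5P[q1 q2 q10 q20 /eqP qc] qp]|].
    have := proper_card (_ : q.2 \proper p.2); rewrite properEneq qp q2 => /(_ isT).
    move: qc (subset_leq_card q1); rewrite q20 eqEcard q1/=.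
    move: #|q.1| #|q.2| #|p.1| #|p.2| => a b c d E ac bd; split=> //; lia.
  move=> [q2 q20 /eqP qc /eqP q1]; rewrite q1 subxx q2 q20 p10/= -qc addnS eqxx; split=> //.
  by apply/eqP => E; move/eqP: qc; rewrite E eqn_leq ltnn.
rewrite (reindex_onto (fun s : {set 'I_m} => (p.1, s)) snd)/=; last first.
  by move=> q /and4P[_ _ _ /eqP <-]; case: q.
rewrite -big_mkcondr; apply: eq_bigl => s; rewrite !eqxx !andbT/=.
by rewrite -andbA [(_ != _) && _]andbC.
Qed.

Definition vkN p : 'F_2 := vk_cochain K lam (cdim p) p.

Lemma vkN0 p : p \in dcells K -> cdim p = 0%N -> vkN p = 1.
Proof. by move=> pK p0; rewrite /vkN p0 vk_cochain0. Qed.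

(** A flag that ends at p and has as many cells as the dimension of p allows
    passes through a facet of p. *)
Lemma vkNS n p : p \in dcells K -> cdim p = n.+1 ->
  vkN p = face_sum (fun q => w1 lam q p * vkN q) p.
Proof.
move=> pK pn; rewrite -(sum_facets _ pK pn) {1}/vkN pn vk_cochainS//.
rewrite [RHS]big_mkcond [LHS]big_mkcond/=; apply: eq_bigr => q _.
case: (boolP (q \in dcells K)) => //= qK; case: (boolP (proper_face q p)) => //= qp.
case: eqP => [qn|qn]; first by rewrite /vkN qn.
have [->|/(vk_cochain_dim qK) nq] := eqVneq (vk_cochain K lam n q) 0.
  by rewrite mulr0.
have := cdim_proper_face pK qK qp; rewrite pn ltnS => qn'.
by case: qn; apply/eqP; rewrite eqn_leq qn'.
Qed.

Lemma eq_face_sum (F F' : cell -> 'F_2) p : p \in dcells K ->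
  (forall q, q \in dcells K -> (cdim q < cdim p)%N -> F q = F' q) ->
  face_sum F p = face_sum F' p.
Proof.
move=> pK FF; have face q : q \in dcells K -> proper_face q p -> F q = F' q.
  by move=> qK qp; apply: FF => //; exact: cdim_proper_face.
have [_ p10 p20] : [/\ p \in jcells K, p.1 != set0 & p.2 != set0].
  by move: pK; rewrite dcellsE => /and3P[].
congr (_ + _); apply: eq_bigr => v vp; case: ifPn => // v0; apply: face.
- by rewrite (dcells_face pK) ?subD1set.
- rewrite /proper_face /= subD1set subxx !andbT; apply/eqP => /(congr1 fst)/= E.
  by have := setD11 v p.1; rewrite E vp.
- by rewrite (dcells_face pK) ?subD1set.
- rewrite /proper_face /= subD1set subxx !andbT; apply/eqP => /(congr1 snd)/= E.
  by have := setD11 v p.2; rewrite E vp.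
Qed.

Hypothesis lamP : classifying K lam.

Lemma w1_swap p q : p \in dcells K -> q \in dcells K ->
  w1 lam (swap_cell p) (swap_cell q) = w1 lam p q.
Proof. by move=> pK qK; rewrite /w1 /swap_cell !lamP//; case: (lam p) (lam q) => -[]. Qed.

Lemma vkN_swap p : p \in dcells K -> vkN (swap_cell p) = vkN p.
Proof.
have [n] := ubnP (cdim p); elim: n p => // n IH p pn pK.
have spK : swap_cell p \in dcells K by rewrite dcells_swap.
have sd : cdim (swap_cell p) = cdim p by rewrite /cdim addnC.
case pd : (cdim p) => [|k]; first by rewrite !vkN0// sd.
rewrite (vkNS pK pd) (vkNS spK (_ : _ = k.+1)) ?sd//.
rewrite {1}/face_sum /= addrC
  -/(face_sum (fun q => w1 lam (swap_cell q) (swap_cell p) * vkN (swap_cell q)) p).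
apply: eq_face_sum => // q qK qp; rewrite w1_swap// IH//.
exact: leq_trans qp pn.
Qed.

(** On cells of the deleted product this counts the alternating full flags that
    start with the label true: the label of their top cell is determined by the
    parity of its dimension.  On the two copies of the complex in the deleted
    join the values are those of the labelling by true and false; an edge with
    different labels at its ends crosses the deleted product in a vertex, which
    is how the class of degree n of the deleted product becomes the class of
    degree n + 1 of the deleted join. *)
Definition alpha p : 'F_2 :=
  if p.1 == set0 then (p.2 == set0)%:R else
  if p.2 == set0 then (#|p.1| == 1)%:R else
  if lam p (+) odd (cdim p) then vkN p else 0.

Lemma alpha_dcells p : p \in dcells K ->
  alpha p = if lam p (+) odd (cdim p) then vkN p else 0.
Proof. by rewrite dcellsE /alpha => /and3P[_ /negPf -> /negPf ->]. Qed.

Lemma alphaD_swap p : p \in dcells K -> alpha p + alpha (swap_cell p) = vkN p.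
Proof.
move=> pK; rewrite !alpha_dcells ?dcells_swap// vkN_swap//.
have -> : lam (swap_cell p) = ~~ lam p by exact: lamP.
have -> : cdim (swap_cell p) = cdim p by rewrite /cdim addnC.
by rewrite addNb; case: (_ (+) _); rewrite /= ?addr0 ?add0r.
Qed.

Lemma cob_alpha_degenerate p : p != (set0, set0) -> (p.1 == set0) || (p.2 == set0) ->
  cob alpha p = alpha p + alpha (swap_cell p).
Proof.
case: p => s t; rewrite xpair_eqE /= => st0.
have D1 (v : 'I_m) (r : {set 'I_m}) : v \in r -> (#|r :\ v|.+1 = #|r|)%N.
  by move=> vr; rewrite [RHS](cardsD1 v) vr.
case: (eqVneq s set0) st0 => [->/= t0 _|s0 _ /= /eqP ->].
  rewrite /cob /alpha /= eqxx big_set0 add0r (negPf t0) add0r.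
  rewrite (eq_bigr (fun=> (#|t| == 1)%:R)) => [|v vt]; last first.
    by rewrite -cards_eq0 -(D1 v t vt).
  by rewrite sumr_const; case: (#|t| =P 1%N) => [->|_]; rewrite ?mulr1n ?mul0rn.
rewrite /cob /alpha /= eqxx big_set0 addr0 (negPf s0) addr0.
rewrite (eq_bigr (fun=> (#|s| == 1)%:R + (#|s| == 2)%:R)) => [|v vs]; last first.
  by rewrite -cards_eq0 -(D1 v s vs); case: #|_| => [|[|k]]; rewrite ?addr0 ?add0r.
rewrite sumr_const; case: #|s| => [|[|[|k]]]; rewrite ?mulr1n ?addr0 ?mul0rn//.
by rewrite add0r mulr2n addrr_F2.
Qed.

Lemma cob_dcells (u : cell -> 'F_2) p : p \in dcells K ->
  (forall t, (1 < #|t|)%N -> u (set0, t) = 0) ->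
  (forall s, (1 < #|s|)%N -> u (s, set0) = 0) -> (0 < cdim p)%N ->
  cob u p = face_sum u p.
Proof.
move=> pK ul ur pd; have := cdim_dcells pK => pc.
rewrite /cob /face_sum; congr (_ + _); apply: eq_bigr => v vp; case: ifPn => //.
  rewrite negbK => /eqP E; rewrite E ul//; have := cardsD1 v p.1.
  by rewrite vp E cards0; move: pc; move: #|p.1| #|p.2| => a b; lia.
rewrite negbK => /eqP E; rewrite E ur//; have := cardsD1 v p.2.
by rewrite vp E cards0; move: pc; move: #|p.1| #|p.2| => a b; lia.
Qed.

(** Let k be the dimension of the facets of p.  If [lam p = odd k], both sides
    count the flags through the facets labelled differently from p.  Otherwise
    they count flags through complementary sets of facets, and their sum is the
    sum of [vkN] over all facets, which by induction is a coboundary of a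
    coboundary. *)
Lemma cob_alpha p : p \in dcells K -> cob alpha p = vkN p.
Proof.
have [n] := ubnP (cdim p); elim: n p => // n IH p pn pK.
have [pJ p10 p20] : [/\ p \in jcells K, p.1 != set0 & p.2 != set0].
  by move: pK; rewrite dcellsE => /and3P[].
have al t : (1 < #|t|)%N -> alpha (set0, t) = 0.
  by rewrite /alpha /= eqxx -cards_eq0; case: #|t|.
have ar s : (1 < #|s|)%N -> alpha (s, set0) = 0.
  by rewrite /alpha /= eqxx -cards_eq0; case: #|s| => [|[]].
have pc := cdim_dcells pK.
case pd : (cdim p) => [|k].
  rewrite vkN0//; move: pc; rewrite pd => pc.
  have [c1 c2] : #|p.1| = 1%N /\ #|p.2| = 1%N.
    have : (0 < #|p.1|)%N by rewrite card_gt0.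
    have : (0 < #|p.2|)%N by rewrite card_gt0.
    by move: pc; move: #|p.1| #|p.2| => a b; lia.
  have /cards1P[v pv] : #|p.1| == 1%N by rewrite c1.
  have /cards1P[w pw] : #|p.2| == 1%N by rewrite c2.
  rewrite /cob pv pw !big_set1 !setDv /alpha /= eqxx -!cards_eq0 !cards1 /=.
  by rewrite add0r.
have -> : cob alpha p = face_sum (fun q => if lam q (+) odd k then vkN q else 0) p.
  rewrite cob_dcells// ?pd// -(sum_facets _ pK pd) -[RHS](sum_facets _ pK pd).
  by apply: eq_bigr => q /and3P[qK _ /eqP qk]; rewrite alpha_dcells// qk.
rewrite (vkNS pK pd); have [lo|lo] := eqVneq (lam p) (odd k).
  congr (_ + _); apply: eq_bigr => v _; case: ifP => // _; rewrite /w1 -lo;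
  by case: (lam _ (+) lam p); rewrite ?mul1r ?mul0r.
apply: eq_F2.
(* The sum of the two sides, which is to vanish since -1 = 1. *)
have cobN q : q \in dcells K -> (cdim q < cdim p)%N -> cob alpha q = vkN q.
  by move=> qK qp; apply: IH => //; exact: leq_trans qp pn.
have lamN q : (if lam q (+) odd k then vkN q else 0) + w1 lam q p * vkN q = vkN q.
  have -> : odd k = ~~ lam p by case: (odd k) (lam p) lo => -[].
  rewrite /w1; case: (lam q) (lam p) => -[] /=; rewrite ?mul1r ?mul0r ?addr0 ?add0r//.
have -> (F F' : cell -> 'F_2) : face_sum F p + face_sum F' p = face_sum (fun q => F q + F' q) p.
  rewrite /face_sum addrACA -!big_split/=.
  by congr (_ + _); apply: eq_bigr => v _; case: ifP => _; rewrite ?addr0.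
rewrite (eq_face_sum (F' := cob alpha) pK) => [|q qK qp]; last by rewrite lamN cobN.
rewrite -cob_dcells ?pd// ?cob_cob// => t t1.
  rewrite cob_alpha_degenerate/= ?eqxx// ?xpair_eqE ?al ?ar ?addr0 ?eqxx/=//.
  by rewrite -cards_eq0; case: #|t| t1.
rewrite cob_alpha_degenerate/= ?eqxx// ?orbT ?xpair_eqE ?al ?ar ?addr0 ?eqxx ?andbT/=//.
by rewrite -cards_eq0; case: #|t| t1.
Qed.

Lemma alpha_is_system : alpha_system K alpha.
Proof.
move=> p pJ p0; have [pd|pd] := boolP ((p.1 == set0) || (p.2 == set0)).
  exact: cob_alpha_degenerate.
have pK : p \in dcells K by rewrite dcellsE pJ -negb_or.
by rewrite cob_alpha// alphaD_swap.
Qed.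

Lemma alpha00 : alpha (set0, set0) = 1.
Proof. by rewrite /alpha /= !eqxx. Qed.

Lemma vk_cochain_alpha n p : p \in ncells K n ->
  vk_cochain K lam n p = alpha p + alpha (swap_cell p).
Proof. by rewrite inE => /andP[pK /eqP pn]; rewrite alphaD_swap// /vkN /cdim pn. Qed.

End Flags.

(** * The van Kampen pairing of a join *)

Section Pairing.
Context {m : nat}.
Implicit Types (p q : cell (m := m)) (c : chain (m := m)).

Definition mod2 (x : cell (m := m) -> int) p : 'F_2 := (x p)%:~R.

Lemma jbd_mod2 (x : cell -> int) p : jbd (mod2 x) p = (jbd x p)%:~R.
Proof.
rewrite /jbd /mod2 !sign_F2 mul1r rmorphD rmorphM !rmorph_sum rmorphXn rmorphN1 sign_F2 mul1r /=.
by congr (_ + _); apply: eq_bigr => v _; rewrite rmorphM rmorphXn rmorphN1.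
Qed.

Lemma jtrace_mod2 n (x : cell -> int) p :
  mod2 (jtrace n (jconv x)) p = mod2 x p + mod2 x (swap_cell p).
Proof.
rewrite /mod2 /jtrace /jswap /jconv rmorphD !rmorphM !rmorphXn !rmorphN1 /=.
by rewrite !sign_F2 !mul1r.
Qed.

Variables (K : scomplex m) (lam : cell (m := m) -> bool).
Hypothesis lamP : classifying K lam.

Lemma vk_pairing_alpha n c : is_chain K n c -> vk_pairing K lam n c =
  \sum_p mod2 c p * (alpha K lam p + alpha K lam (swap_cell p)).
Proof.
move=> cn; rewrite /vk_pairing [LHS]big_mkcond; apply: eq_bigr => p _.
by case: ifPn => [/(vk_cochain_alpha lamP) ->//|/cn]; rewrite /mod2 => ->; rewrite mul0r.
Qed.

(** Any system computes the van Kampen pairing of a cycle up to its value at the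
    empty cell; in particular the pairing does not depend on the labelling. *)
Lemma alpha_system_pairing (u : cell -> 'F_2) n c : alpha_system K u ->
  is_chain K n c -> (forall p, jbd (jtrace n (jconv c)) p = 0) ->
  \sum_p mod2 c p * (u p + u (swap_cell p)) = u (set0, set0) * vk_pairing K lam n c.
Proof.
move=> us cn cc; rewrite vk_pairing_alpha// big_distrr/=; apply: eq_F2.
rewrite -big_split/=.
(* The two systems agree at the empty cell after scaling that of lam. *)
pose u' p := u p + u (set0, set0) * alpha K lam p.
rewrite (eq_bigr (fun p => mod2 c p * (u' p + u' (swap_cell p)))); last first.
  by move=> p _; rewrite /u'; ring.
have cN p : p \notin ncells K n -> mod2 c p = 0 by rewrite /mod2 => /cn ->.
apply: (@alpha_system_pairing0 _ K).
- move=> p pJ p0; rewrite /u' cobD cobZ us// (alpha_is_system lamP)//; ring.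
- by rewrite /u' alpha00 mulr1 addrr_F2.
- by move=> p pJ; rewrite cN// ncellsE dcellsE (negPf pJ).
- by rewrite cN// ncellsE dcellsE eqxx !andbF.
- move=> p; rewrite -(jbd_ext (jtrace_mod2 n c)) jbd_mod2 cc.
  exact: rmorph0.
Qed.

End Pairing.

Section Join.
Context {m1 m2 : nat}.
Variables (K1 : scomplex m1) (K2 : scomplex m2).

Definition join_simplices : {set {set 'I_(m1 + m2)}} :=
  [set s | [&& s != set0, (lpart s == set0) || (lpart s \in simplices K1)
    & (rpart s == set0) || (rpart s \in simplices K2)]].

Lemma join_neq0 : set0 \notin join_simplices.
Proof. by rewrite inE eqxx. Qed.

Lemma join_face (s t : {set 'I_(m1 + m2)}) : s \in join_simplices ->
  t \subset s -> t != set0 -> t \in join_simplices.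
Proof.
rewrite !inE => /and3P[_ sl sr] ts -> /=.
have ll : lpart t \subset lpart s.
  by apply/subsetP => i; rewrite !inE; apply: (subsetP ts).
have rr : rpart t \subset rpart s.
  by apply/subsetP => i; rewrite !inE; apply: (subsetP ts).
apply/andP; split.
  case: (eqVneq (lpart t) set0) => //= t0; case/orP: sl => [/eqP s0|sK].
    by move: ll; rewrite s0 subset0 (negPf t0).
  exact: simplex_face ll t0.
case: (eqVneq (rpart t) set0) => //= t0; case/orP: sr => [/eqP s0|sK].
  by move: rr; rewrite s0 subset0 (negPf t0).
exact: simplex_face rr t0.
Qed.

Lemma join_vertex (v : 'I_(m1 + m2)) : [set v] \in join_simplices.
Proof.
have s1n (i : 'I_(m1 + m2)) : [set i] != set0.
  by apply/set0Pn; exists i; rewrite set11.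
move: v; apply: ord_sumP => v; rewrite inE s1n /=.
  have -> : lpart [set lshift m2 v] = [set v].
    by apply/setP => i; rewrite !inE (inj_eq (@lshift_inj _ _)).
  have -> : rpart [set lshift m2 v] = set0.
    by apply/setP => i; rewrite !inE eq_rlshift.
  by rewrite simplex_vertex orbT eqxx.
have -> : rpart [set rshift m1 v] = [set v].
  by apply/setP => i; rewrite !inE (inj_eq (@rshift_inj _ _)).
have -> : lpart [set rshift m1 v] = set0.
  by apply/setP => i; rewrite !inE eq_lrshift.
by rewrite simplex_vertex orbT eqxx.
Qed.

Definition join : scomplex (m1 + m2) := SComplex join_neq0 join_face join_vertex.

Lemma jcells_join (p : cell) :
  (p \in jcells join) = (lcell p \in jcells K1) && (rcell p \in jcells K2).
Proof.
have E (s : {set 'I_(m1 + m2)}) : (s == set0) || (s \in simplices join) =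
    ((lpart s == set0) || (lpart s \in simplices K1)) &&
    ((rpart s == set0) || (rpart s \in simplices K2)).
  by rewrite inE parts_eq0; do 2 case: (_ == set0) => //=.
rewrite [LHS]inE !E disjoint_parts [in RHS]inE [X in _ = _ && X]inE /=.
case: ((lpart p.1 == _) || _); case: ((rpart p.1 == _) || _); rewrite ?andbF//=.
by case: ((lpart p.2 == _) || _); case: ((rpart p.2 == _) || _); rewrite ?andbF.
Qed.

Lemma ncells_join n1 n2 (p : cell) : lcell p \in ncells K1 n1 ->
  rcell p \in ncells K2 n2 -> p \in ncells join (n1 + n2 + 2).
Proof.
rewrite !ncellsE !dcellsE jcells_join => /andP[/and3P[-> l1 l2] /eqP lc].
move=> /andP[/and3P[-> r1 r2] /eqP rc]; rewrite !parts_eq0 (negPf l1) (negPf l2)/=.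
move: lc rc; rewrite /= !card_parts.
by move: #|_| #|_| #|_| #|_| => a b c d; lia.
Qed.

Variables (H1 H2 : finGroupType) (a1 : Hcomplex H1 K1) (a2 : Hcomplex H2 K2).

Definition join_map (h : H1 * H2) : 'I_(m1 + m2) -> 'I_(m1 + m2) :=
  sum_map (a1 h.1) (a2 h.2).

Lemma join_map1 v : join_map 1%g v = v.
Proof. by move: v; apply: ord_sumP => v; rewrite /join_map ?(sum_map_l, sum_map_r) lact1. Qed.

Lemma join_mapM g h v : join_map (g * h)%g v = join_map g (join_map h v).
Proof.
by move: v; apply: ord_sumP => v; rewrite /join_map ?(sum_map_l, sum_map_r) lactM.
Qed.

Definition join_action : left_action (H1 * H2)%type 'I_(m1 + m2) :=
  LeftAction join_map1 join_mapM.

Lemma join_map_simplicial (h : (H1 * H2)%type) (s : {set 'I_(m1 + m2)}) :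
  s \in simplices join -> (join_action h @: s)%SET \in simplices join.
Proof.
rewrite !inE => /and3P[s0 sl sr]; apply/and3P; split.
- by rewrite -card_gt0 card_imset ?card_gt0//; apply: (can_inj (g := join_map (h^-1)%g)) => v;
    rewrite -join_mapM mulVg join_map1.
- rewrite lpart_map; case/orP: sl => [/eqP ->|sK]; first by rewrite imset0 eqxx.
  by rewrite Hact_simplicial ?orbT.
- rewrite rpart_map; case/orP: sr => [/eqP ->|sK]; first by rewrite imset0 eqxx.
  by rewrite Hact_simplicial ?orbT.
Qed.

Definition join_complex : Hcomplex (H1 * H2)%type join := HComplex join_map_simplicial.

Section Cycle.
Variables (n1 n2 : nat) (c1 : chain (m := m1)) (c2 : chain (m := m2)).
Hypotheses (cn1 : is_chain K1 n1 c1) (cn2 : is_chain K2 n2 c2).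
Hypothesis cc1 : forall p, jbd (jtrace n1 (jconv c1)) p = 0.
Hypothesis cc2 : forall p, jbd (jtrace n2 (jconv c2)) p = 0.

Let z1 := jtrace n1 (jconv c1).
Let z2 := jtrace n2 (jconv c2).

(** The transfer is applied to the first factor only, since applying it to both
    would give twice the wanted class. *)
Definition join_chain : chain (m := m1 + m2) :=
  [ffun p : cell => (-1) ^+ #|p.2| * jprod (jtrace n1 (jconv c1)) (jconv c2) p].

Lemma jconv_join : jconv join_chain =1 jprod z1 (jconv c2).
Proof. by move=> p; rewrite /jconv ffunE signrMK. Qed.

Lemma join_chainP : is_chain join (n1 + n2 + 2) join_chain.
Proof.
move=> p pn; rewrite ffunE /jprod.
have [l|l] := boolP (lcell p \in ncells K1 n1); last first.
  by rewrite (jtrace_chain0 cn1 l) mul0r !mulr0.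
have [r|r] := boolP (rcell p \in ncells K2 n2); last first.
  by rewrite /jconv (cn2 r) !mulr0.
by move: pn; rewrite ncells_join.
Qed.

Lemma jtrace_join p : jtrace (n1 + n2 + 2) (jconv join_chain) p = jprod z1 z2 p.
Proof.
transitivity (jtrace (n1 + n2) (jprod z1 (jconv c2)) p).
  rewrite /jtrace /jswap !jconv_join; congr (_ + _ * _).
  by apply: eq_signr; rewrite addn2 /= negbK.
by apply: jtrace_prod => q; exact: jswap_trace.
Qed.

Lemma join_jcycle p : jbd (jtrace (n1 + n2 + 2) (jconv join_chain)) p = 0.
Proof. by rewrite (jbd_ext jtrace_join) jbd_prod cc1 cc2 mul0r !(mulr0, addr0). Qed.

Lemma sum_ucell (F : cell -> 'F_2) :
  \sum_p F p = \sum_(p2 : cell (m := m2)) \sum_(p1 : cell (m := m1)) F (ucell p1 p2).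
Proof.
rewrite exchange_big pair_bigA /=.
rewrite (reindex (fun q : cell (m := m1) * cell (m := m2) => ucell q.1 q.2))//=.
exists (fun p => (lcell p, rcell p)) => [[p1 p2]|p] _ /=.
  by rewrite lcell_ucell rcell_ucell.
exact: ucell_parts.
Qed.

Lemma cob_ucell (u : cell -> 'F_2) (p1 : cell (m := m1)) (p2 : cell (m := m2)) :
  cob u (ucell p1 p2) =
  cob (fun q => u (ucell q p2)) p1 + cob (fun q => u (ucell p1 q)) p2.
Proof.
have dl (s1 : {set 'I_m1}) (s2 : {set 'I_m2}) v :
    usum s1 s2 :\ lshift m2 v = usum (s1 :\ v) s2.
  by rewrite -[LHS]usum_parts lpart_ldel rpart_ldel lpart_usum rpart_usum.
have dr (s1 : {set 'I_m1}) (s2 : {set 'I_m2}) v :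
    usum s1 s2 :\ rshift m1 v = usum s1 (s2 :\ v).
  by rewrite -[LHS]usum_parts lpart_rdel rpart_rdel lpart_usum rpart_usum.
rewrite /cob /ucell /= !big_split_ord/= addrACA.
by congr (_ + _ + (_ + _)); apply: eq_big => v; rewrite ?inE ?split_l ?split_r// ?dl ?dr.
Qed.

Variables (lam1 : cell (m := m1) -> bool) (lam2 : cell (m := m2) -> bool).
Variable lam : cell (m := m1 + m2) -> bool.
Hypotheses (lamP1 : classifying K1 lam1) (lamP2 : classifying K2 lam2).
Hypothesis lamP : classifying join lam.

(** The slant product of a system on the join with the transfer of c1 is a system
    b on the second complex, because that transfer is an invariant cycle.  The
    value of b at the empty cell is the pairing of c1 with the restriction of
    the system to the first complex. *)
Lemma vk_pairing_join : vk_pairing join lam (n1 + n2 + 2) join_chain =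
  vk_pairing K1 lam1 n1 c1 * vk_pairing K2 lam2 n2 c2.
Proof.
rewrite (vk_pairing_alpha lamP join_chainP); set a := alpha join lam.
have asys : alpha_system join a := alpha_is_system lamP.
(* zb is the transfer of c1 modulo 2, and b the slant product of a with it. *)
pose zb p := mod2 c1 p + mod2 c1 (swap_cell p).
pose b (q : cell (m := m2)) := \sum_p1 zb p1 * a (ucell p1 q).
have zbS p : zb (swap_cell p) = zb p by rewrite /zb swap_cellK addrC.
have zbJ p : p \notin jcells K1 -> zb p = 0.
  move=> pJ; rewrite /zb /mod2 !cn1 ?addr0//.
    by rewrite ncells_swap ncellsE dcellsE (negPf pJ).
  by rewrite ncellsE dcellsE (negPf pJ).
have ucell00 : ucell (set0, set0) (set0, set0) = (set0, set0) :> cell (m := m1 + m2).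
  have E : usum set0 set0 = set0 :> {set 'I_(m1 + m2)}.
    by apply/setP => i; rewrite !inE; case: split => j; rewrite inE.
  by rewrite /ucell /= E.
have ucellN0 (p1 : cell) (p2 : cell) : (p1 != (set0, set0)) || (p2 != (set0, set0)) ->
    ucell p1 p2 != (set0, set0).
  apply: contraTneq => E; rewrite negb_or !negbK.
  have e1 := lcell_ucell p1 p2; have e2 := rcell_ucell p1 p2.
  rewrite E in e1 e2; rewrite -e1 -e2 /lcell /rcell /=.
  by apply/andP; split; apply/eqP; congr pair; apply/setP => i; rewrite !inE.
have bsys : alpha_system K2 b.
  move=> q qJ q0.
  have -> : cob b q = \sum_p1 zb p1 * cob (fun q' => a (ucell p1 q')) q.
    rewrite /cob /b exchange_big/= [X in _ + X]exchange_big/= -big_split/=.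
    by apply: eq_bigr => p1 _; rewrite mulrDr !big_distrr.
  have : \sum_p1 zb p1 * cob (fun q' => a (ucell q' q)) p1 = 0.
    rewrite jbd_cob big1// => p1 _.
    rewrite -(jbd_ext (jtrace_mod2 n1 c1)) jbd_mod2 cc1.
    by rewrite (_ : 0%:~R = 0) ?mul0r//; exact: rmorph0.
  move=> Z; rewrite -[LHS]add0r -{1}Z -big_split/=.
  have -> : b (swap_cell q) = \sum_p1 zb p1 * a (swap_cell (ucell p1 q)).
    rewrite /b -sum_swap; apply: eq_bigr => p1 _.
    by rewrite zbS.
  rewrite /b -big_split/=; apply: eq_bigr => p1 _; rewrite -!mulrDr -cob_ucell.
  have [pJ|pJ] := boolP (p1 \in jcells K1); last by rewrite zbJ// !mul0r.
  rewrite asys// ?ucellN0 ?q0 ?orbT//.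
  by rewrite jcells_join lcell_ucell rcell_ucell pJ.
have b0 : b (set0, set0) = vk_pairing K1 lam1 n1 c1.
  pose u (p1 : cell) := a (ucell p1 (set0, set0)).
  have us : alpha_system K1 u.
    move=> p pJ p0; have := asys (ucell p (set0, set0)).
    rewrite jcells_join lcell_ucell rcell_ucell pJ ucellN0 ?p0//= !inE eqxx/=.
    rewrite -setI_eq0 setIid eqxx => /(_ isT isT) => <-; rewrite cob_ucell.
    by rewrite [X in _ = _ + X]/cob /= !big_set0 !addr0.
  have u0 : u (set0, set0) = 1 by rewrite /u ucell00 /a alpha00.
  have := alpha_system_pairing lamP1 us cn1 cc1.
  rewrite u0 mul1r => <-.
  rewrite /b /zb; under eq_bigr do rewrite mulrDl; rewrite big_split/=.
  rewrite -[X in _ + X]sum_swap -big_split/=; apply: eq_bigr => p _.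
  by rewrite swap_cellK mulrDr.
rewrite -b0 -(alpha_system_pairing lamP2 bsys cn2 cc2) sum_ucell.
apply: eq_bigr => q _.
have red_join p1 : mod2 join_chain (ucell p1 q) = zb p1 * mod2 c2 q.
  rewrite {1}/mod2 ffunE /jprod lcell_ucell rcell_ucell !rmorphM !rmorphXn !rmorphN1 /=.
  rewrite !sign_F2 !mul1r; congr (_ * _).
  exact: (jtrace_mod2 n1 c1 p1).
under eq_bigr do rewrite red_join.
have -> : b (swap_cell q) = \sum_p1 zb p1 * a (swap_cell (ucell p1 q)).
  by rewrite /b -sum_swap; apply: eq_bigr => p1 _; rewrite zbS.
rewrite /b -big_split/= big_distrr/=; apply: eq_bigr => p1 _; rewrite -mulrDr.
by rewrite mulrCA mulrA.
Qed.

End Cycle.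
End Join.

From mathcomp Require Import all_classical all_reals all_analysis.
Import numFieldNormedType.Exports.

Local Open Scope classical_set_scope.

(** * The join of equivariant obstructors *)

Section SquareSubgroup.

Lemma is_subgroup_generated (G : groupType) (A : set G) :
  is_subgroup (Defs.generated A).
Proof.
split=> [P [[P1 _ _] _]//|x y Sx Sy P PA|x Sx P PA].
  by have [[_ PM _] _] := PA; apply: PM; [exact: Sx | exact: Sy].
by have [[_ _ PV] _] := PA; apply: PV; exact: Sx.
Qed.

Lemma sub_generated (G : groupType) (A : set G) : A `<=` Defs.generated A.
Proof. by move=> x Ax P [_]; apply. Qed.

Lemma generated_sub (G : groupType) (A P : set G) : is_subgroup P -> A `<=` P ->
  Defs.generated A `<=` P.
Proof. by move=> PS AP x; apply. Qed.

Variables (G1 G2 : groupType).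

Lemma square_subgroup_proj (g : (G1 * G2)%type) :
  square_subgroup g -> square_subgroup g.1 /\ square_subgroup g.2.
Proof.
have [s1 sM sV] := is_subgroup_generated (range (fun g : G1 => (g * g)%g)).
have [t1 tM tV] := is_subgroup_generated (range (fun g : G2 => (g * g)%g)).
move: g; apply: generated_sub.
  split=> [//|x y [x1 x2] [y1 y2]|x [x1 x2]]; first by split; [exact: sM | exact: tM].
  by split; [exact: sV | exact: tV].
by move=> _ [x _ <-]; split; apply: sub_generated; [exists x.1 | exists x.2].
Qed.

Lemma square_subgroup_pair (g1 : G1) (g2 : G2) : square_subgroup g1 ->
  square_subgroup g2 -> square_subgroup ((g1, g2) : (G1 * G2)%type).
Proof.
pose S : set (G1 * G2)%type := @square_subgroup (G1 * G2)%type.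
have [s1 sM sV] : is_subgroup S by exact: is_subgroup_generated.
have sq (x : (G1 * G2)%type) : S (x * x)%g by apply: sub_generated; exists x.
have pairM (x y : (G1 * G2)%type) : (x * y)%g = ((x.1 * y.1)%g, (x.2 * y.2)%g) by [].
have pairV (x : (G1 * G2)%type) : (x^-1)%g = ((x.1^-1)%g, (x.2^-1)%g) by [].
have l : @square_subgroup G1 `<=` [set x : G1 | S (x, 1%g)].
  apply: generated_sub => [|_ [x _ <-]]; last first.
    by have := sq (x, 1%g); rewrite pairM /= mulg1.
  split=> [//|x y xS yS|x xS] /=.
    by have := sM _ _ xS yS; rewrite pairM /= mulg1.
  by have := sV _ xS; rewrite pairV /= invg1.
have r : @square_subgroup G2 `<=` [set x : G2 | S (1%g, x)].
  apply: generated_sub => [|_ [x _ <-]]; last first.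
    by have := sq (1%g, x); rewrite pairM /= mulg1.
  split=> [//|x y xS yS|x xS] /=.
    by have := sM _ _ xS yS; rewrite pairM /= mulg1.
  by have := sV _ xS; rewrite pairV /= invg1.
by move=> /l S1 /r S2; have := sM _ _ S1 S2; rewrite pairM /= mulg1 mul1g.
Qed.

End SquareSubgroup.

Lemma equivariant_obstructor_join (m1 m2 : nat) (K1 : scomplex m1) (K2 : scomplex m2)
    (H1 H2 : finGroupType) (a1 : Hcomplex H1 K1) (a2 : Hcomplex H2 K2) (n1 n2 : nat) :
  equivariant_obstructor a1 n1 -> equivariant_obstructor a2 n2 ->
  equivariant_obstructor (join_complex a1 a2) (n1 + n2 + 2).
Proof.
move=> [c1 [cn1 bd1 [lam1 lamP1 vk1] sum1] [A1 [A10 A1S] A1c]].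
move=> [c2 [cn2 bd2 [lam2 lamP2 vk2] sum2] [A2 [A20 A2S] A2c]].
have cc1 : forall p, jbd (jtrace n1 (jconv c1)) p = 0 by apply/(coinv_zero_jcycle cn1).
have cc2 : forall p, jbd (jtrace n2 (jconv c2)) p = 0 by apply/(coinv_zero_jcycle cn2).
have cn := join_chainP cn1 cn2.
have [bd sum0] := (coinv_zero_jcycle cn).2 (join_jcycle cc1 cc2).
exists (join_chain n1 c1 c2).
  split=> //; pose lam (p : cell (m := m1 + m2)) := (enum_rank p.1 < enum_rank p.2)%N.
  have lamP : classifying (join K1 K2) lam.
    move=> p; rewrite dcellsE => /and3P[pJ p10 _]; rewrite /lam /=.
    case: ltngtP => // /ord_inj/enum_rank_inj p12.
    by move: p10; rewrite (jcells_diag pJ) ?eqxx.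
  by exists lam => //; rewrite (vk_pairing_join cn1 cn2 cc1 cc2 lamP1 lamP2 lamP) mulf_neq0.
(* The sum of the translates of a tensor product by A1 x A2 is the tensor
   product of two sums, of which the first vanishes. *)
exists (finset.setX A1 A2).
  split.
    have /set0Pn[h1 h1A] := A10; have /set0Pn[h2 h2A] := A20.
    by apply/set0Pn; exists (h1, h2); rewrite finset.in_setX h1A.
  move=> [h1 h2]; rewrite finset.in_setX => /andP[h1A h2A].
  exact: square_subgroup_pair (A1S _ h1A) (A2S _ h2A).
apply/(coinv_zero_push _ _ cn) => p.
have A1p := (coinv_zero_push a1 A1 cn1).1 A1c (lcell p).
transitivity (\sum_(h in finset.setX A1 A2) jprod (jpush (a1 h.1) (jtrace n1 (jconv c1)))
    (jpush (a2 h.2) (jtrace n2 (jconv c2))) p).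
  apply: eq_bigr => h _; rewrite (jpush_ext _ (jtrace_join n1 n2 c1 c2)).
  by apply: jpush_prod; [exact: lactK | exact: lactVK | exact: lactK | exact: lactVK].
rewrite -big_distrr/=.
rewrite (eq_bigl (fun h : H1 * H2 => (h.1 \in A1) && (h.2 \in A2))); last first.
  by move=> [h1 h2]; rewrite finset.in_setX.
rewrite -(pair_big (mem A1) (mem A2) (fun h1 h2 =>
  jpush (a1 h1) (jtrace n1 (jconv c1)) (lcell p) *
  jpush (a2 h2) (jtrace n2 (jconv c2)) (rcell p)))/=.
under eq_bigr do rewrite -big_distrr/=.
by rewrite -big_distrl/= A1p mul0r mulr0.
Qed.

(** * Products of CW complexes and of models of EG *)

Lemma within_continuous_cvg (S T : topologicalType) (A : set S) (f : S -> T) x :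
  {within A, continuous f} ->
  A x -> f @ within A (nbhs x) --> f x.
Proof. by move=> /subspace_continuousP; apply. Qed.

Lemma within_continuous_precomp (S T U : topologicalType) (A : set T) (B : set S)
    (f : T -> U) (g : S -> T) :
  {within A, continuous f} -> {within B, continuous g} -> (forall x, B x -> A (g x)) ->
  {within B, continuous (fun x => f (g x))}.
Proof.
move=> fc gc gBA; apply/subspace_continuousP => x Bx.
have gx := within_continuous_cvg gc Bx.
have fx := within_continuous_cvg fc (gBA _ Bx).
move=> W Wfg.
have AW : \forall y \near g x, A y -> W (f y) := fx W Wfg.
have BW : \forall y \near x, B y -> A (g y) -> W (f (g y)) := gx _ AW.
change (\forall y \near x, B y -> W (f (g y))).
by apply: filterS BW => y yW By; apply: yW => //; exact: gBA.
Qed.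

Arguments within_continuous_precomp {S T U A B f g}.

Lemma within_continuous_pair (S T U : topologicalType) (A : set S) (f : S -> T) (g : S -> U) :
  {within A, continuous f} -> {within A, continuous g} ->
  {within A, continuous (fun x => (f x, g x))}.
Proof.
move=> fc gc; apply/subspace_continuousP => x Ax.
by apply: cvg_pair; [exact: within_continuous_cvg fc Ax | exact: within_continuous_cvg gc Ax].
Qed.

Arguments within_continuous_pair {S T U A f g}.

Lemma within_closed_preimage (S T : topologicalType) (A : set S) (f : S -> T)
    (C : set T) : closed A ->
  {within A, continuous f} -> closed C -> closed (A `&` f @^-1` C).
Proof.
move=> clA /continuous_closedP fc /fc/closed_subspaceP[W clW WA].
by rewrite setIC -WA; exact: closedI.
Qed.

Lemma closed_bigcup_finite (T : topologicalType) (I : Type) (F : set I) (C : I -> set T) :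
  finite_set F -> (forall i, F i -> closed (C i)) -> closed (\bigcup_(i in F) C i).
Proof. exact: (@closed_bigcup T {classic I}). Qed.

Section ProductMetric.
Context {R : realType} (T1 T2 : metricType R).
Implicit Types x y : (T1 * T2)%type.

Definition prod_mdist x y : R := Num.max (mdist x.1 y.1) (mdist x.2 y.2).

Lemma prod_mdist_ge0 x y : 0 <= prod_mdist x y.
Proof. by rewrite le_max mdist_ge0. Qed.

Lemma prod_mdist_positivity x y : prod_mdist x y = 0 -> x = y.
Proof.
case: x y => x1 x2 [y1 y2] /= xy.
have [d1 d2] : mdist x1 y1 <= 0 /\ mdist x2 y2 <= 0.
  by split; rewrite -xy /prod_mdist /= le_max lexx ?orbT.
congr pair; apply: mdist_positivity; apply/le_anti; by rewrite mdist_ge0 ?d1 ?d2.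
Qed.

Lemma prod_ball_mdist x d : ball x d = [set y | prod_mdist x y < d].
Proof.
apply/seteqP; split=> y /=.
  move=> [/= b1 b2]; move: b1 b2; rewrite !ballEmdist /= => b1 b2.
  by rewrite /prod_mdist gt_max b1.
by rewrite /prod_mdist gt_max => /andP[d1 d2]; split; rewrite /= ballEmdist.
Qed.

HB.instance Definition _ := PseudoMetric_isMetric.Build R (T1 * T2)%type
  prod_mdist_ge0 prod_mdist_positivity prod_ball_mdist.

End ProductMetric.

Section CW.
Context {R : realType}.

Lemma cdisk_compact k : compact (@cdisk R k).
Proof.
have := @rV_compact R k (fun=> `[(-1 : R), 1]) (fun=> @segment_compact R (-1) 1).
congr compact; apply/seteqP; split=> u uk i; have := uk i; rewrite /= in_itv /= ler_norml//.
Qed.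

Lemma cdisk_closed k : closed (@cdisk R k).
Proof. by apply: compact_closed; [exact: norm_hausdorff | exact: cdisk_compact]. Qed.

Lemma odisk_cdisk k : @odisk R k `<=` @cdisk R k.
Proof. by move=> u ou i; exact: ltW. Qed.

(** Points chosen in infinitely many distinct cells would form a set all of whose
    subsets are closed, since each closed cell contains only finitely many of
    them; such a set has no cluster point. *)
Lemma compact_finite_cells (E : topologicalType) (X : @cw_structure R E) (B : set E) :
  compact B -> finite_set [set e : cw_cell X | cw_open e `&` B !=set0].
Proof.
move=> Bc; set M := [set e | _]; apply: contrapT => infM.
have [pt ptP] : exists pt : cw_cell X -> E, forall e, M e -> (cw_open e `&` B) (pt e).
  have : forall e, exists x, M e -> (cw_open e `&` B) x.
    move=> e; have [[x xe]|nM] := pselect (M e); first by exists x.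
    by exists (cw_char (0 : 'rV_(cw_dim e))).
  by move=> /choice[pt ptP]; exists pt.
have closedS (N : set (cw_cell X)) : N `<=` M -> closed (pt @` N).
  move=> NM; apply: (cw_weak (c := X)) => e.
  have [F finF [_ eF]] := cw_closure_finite (c := X) e.
  pose Q := pt @` (N `&` (F `|` [set e])).
  have clQ : closed Q.
    have /accessible_finite_set_closed := hausdorff_accessible (cw_hausdorff X).
    apply; apply: finite_image; apply: (sub_finite_set (@subIsetr _ _ _)).
    by rewrite finite_setU.
  rewrite (_ : _ `&` _ = @cdisk R (cw_dim e) `&` (cw_char (e := e)) @^-1` Q).
    by apply: within_closed_preimage => //; [exact: cdisk_closed | exact: cw_continuous].
  apply/seteqP; split=> u [ud] /=.
    move=> [e' Ne' e'u]; split=> //; exists e' => //; split=> //.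
    have [e'o _] := ptP _ (NM _ Ne').
    have [uo|uo] := pselect (@odisk R (cw_dim e) u).
      by right; apply: (cw_disjoint e'o); rewrite e'u; exists u.
    left; have [] := eF (cw_char u); first by exists u.
    by move=> f Ff fu; rewrite (cw_disjoint e'o (_ : cw_open f _)) // e'u.
  by move=> [e' [Ne' _] e'u]; split=> //; exists e'.
(* The images of the cofinite subsets of M generate a filter; a cluster point p
   of it would be a cluster point of the closed set of the other chosen points. *)
pose F : set_system E := [set P | finite_set (M `&` pt @^-1` (~` P))].
have FF : ProperFilter F.
  split; first by rewrite /F /= setC0 preimage_setT setIT.
  split.
  - by rewrite /F /= setCT preimage_set0 setI0.
  - move=> P Q FP FQ; rewrite /F /= setCI preimage_setU setIUr finite_setU.
    by split.
  - move=> P Q PQ; apply: sub_finite_set; apply: setIS; apply: preimage_subset.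
    exact: subsetC.
have [|p [Bp pF]] := Bc F FF.
  rewrite /F /= (_ : _ `&` _ = set0)//; apply/seteqP; split=> // e [/ptP[_ Be]].
  by move=> /(_ Be).
pose N := M `&` [set e | pt e != p].
have := pF (pt @` M `\ p) (~` (pt @` N)).
case.
- rewrite /F /=; have [[e Me <-]|np] := pselect ((pt @` M) p).
    apply: (@sub_finite_set _ _ [set e]) => //.
    move=> e' [Me' /= ne']; apply: contrapT => e'e; apply: ne'; split; first by exists e'.
    move=> /= ee; apply: e'e; have [e1 _] := ptP _ Me; have [e2 _] := ptP _ Me'.
    by apply: (cw_disjoint e2); rewrite ee.
  rewrite (_ : _ `&` _ = set0)//; apply/seteqP; split=> // e [Me /=]; apply.
  by split; [exists e | move=> ep; apply: np; rewrite -ep; exists e].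
- apply: open_nbhs_nbhs; split.
    by rewrite openC; apply: closedS => e [].
  by move=> /= [e [_ /eqP]].
- move=> x [[[e Me <-] ne] /=]; apply; exists e => //; split=> //.
  exact/eqP.
Qed.

End CW.

Section ProductCW.
Context {R : realType}.

Lemma forall_submx (P : R -> Prop) k1 k2 (u : 'rV[R]_(k1 + k2)) :
  (forall i, P (u 0 i)) <->
  (forall i, P (lsubmx u 0 i)) /\ (forall i, P (rsubmx u 0 i)).
Proof.
split=> [Pu|[Pl Pr] i]; first by split=> i; rewrite mxE.
by case: (split_ordP i) => j ->; [have := Pl j | have := Pr j]; rewrite mxE.
Qed.

Lemma cdisk_submx k1 k2 (u : 'rV[R]_(k1 + k2)) :
  @cdisk R _ u <-> @cdisk R _ (lsubmx u) /\ @cdisk R _ (rsubmx u).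
Proof. exact: (forall_submx (fun x => `|x| <= 1)). Qed.

Lemma odisk_submx k1 k2 (u : 'rV[R]_(k1 + k2)) :
  @odisk R _ u <-> @odisk R _ (lsubmx u) /\ @odisk R _ (rsubmx u).
Proof. exact: (forall_submx (fun x => `|x| < 1)). Qed.

Variables (E1 E2 : topologicalType).
Variables (X1 : @cw_structure R E1) (X2 : @cw_structure R E2).

Definition prod_cell : Type := (cw_cell X1 * cw_cell X2)%type.
Definition prod_dim (e : prod_cell) : nat := (cw_dim e.1 + cw_dim e.2)%N.
Definition prod_char (e : prod_cell) (u : 'rV[R]_(prod_dim e)) : E1 * E2 :=
  (cw_char (e := e.1) (lsubmx u), cw_char (e := e.2) (rsubmx u)).

Lemma prod_open (e : prod_cell) (x : E1 * E2) :
  (@prod_char e @` @odisk R (prod_dim e)) x <-> cw_open e.1 x.1 /\ cw_open e.2 x.2.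
Proof.
split=> [[u /odisk_submx[ul ur] <-]|]; first by split; [exists (lsubmx u) | exists (rsubmx u)].
case: x => x1 x2 /= [[u1 u1o <-] [u2 u2o <-]]; exists (row_mx u1 u2).
  by apply/odisk_submx; rewrite row_mxKl row_mxKr.
by rewrite /prod_char row_mxKl row_mxKr.
Qed.

Lemma prod_hausdorff : hausdorff_space (E1 * E2)%type.
Proof.
move=> [p1 p2] [q1 q2] pq; congr pair.
  apply: (cw_hausdorff X1) => A B Ap Bq.
  have [||[x1 x2] [[/= Ax _] [/= Bx _]]] := pq (A `*` setT) (B `*` setT); last by exists x1.
    by exists (A, setT) => //=; split=> //; exact: filterT.
  by exists (B, setT) => //=; split=> //; exact: filterT.
apply: (cw_hausdorff X2) => A B Ap Bq.
have [||[x1 x2] [[/= _ Ax] [/= _ Bx]]] := pq (setT `*` A) (setT `*` B); last by exists x2.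
  by exists (setT, A) => //=; split=> //; exact: filterT.
by exists (setT, B) => //=; split=> //; exact: filterT.
Qed.

Lemma prod_char_continuous (e : prod_cell) :
  {within @cdisk R (prod_dim e), continuous (@prod_char e)}.
Proof.
have cl : {within @cdisk R (prod_dim e), continuous
    (fun u : 'rV[R]_(cw_dim e.1 + cw_dim e.2) => lsubmx u)}.
  by apply: continuous_subspaceT; exact: continuous_lsubmx.
have cr : {within @cdisk R (prod_dim e), continuous
    (fun u : 'rV[R]_(cw_dim e.1 + cw_dim e.2) => rsubmx u)}.
  by apply: continuous_subspaceT; exact: continuous_rsubmx.
have c1 : {within @cdisk R (cw_dim e.1), continuous (cw_char (e := e.1))}.
  exact: cw_continuous.
have c2 : {within @cdisk R (cw_dim e.2), continuous (cw_char (e := e.2))}.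
  exact: cw_continuous.
apply: (within_continuous_pair (within_continuous_precomp c1 cl _)
  (within_continuous_precomp c2 cr _)) => u /cdisk_submx[]//.
Qed.

Lemma prod_char_injective (e : prod_cell) u v : @odisk R (prod_dim e) u ->
  @odisk R (prod_dim e) v -> prod_char u = prod_char v -> u = v.
Proof.
move=> /odisk_submx[u1 u2] /odisk_submx[v1 v2] [e1 e2].
by rewrite -[u]hsubmxK -[v]hsubmxK (cw_injective u1 v1 e1) (cw_injective u2 v2 e2).
Qed.

Lemma prod_cover (x : E1 * E2) :
  exists e : prod_cell, (@prod_char e @` @odisk R (prod_dim e)) x.
Proof.
have [e1 x1] := cw_cover X1 x.1; have [e2 x2] := cw_cover X2 x.2.
by exists (e1, e2); apply/prod_open.
Qed.

Lemma prod_disjoint (e e' : prod_cell) (x : E1 * E2) :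
  (@prod_char e @` @odisk R (prod_dim e)) x ->
  (@prod_char e' @` @odisk R (prod_dim e')) x -> e = e'.
Proof.
case: e e' => e1 e2 [e1' e2'] /prod_open[/= x1 x2] /prod_open[/= x1' x2'].
by rewrite (cw_disjoint x1 x1') (cw_disjoint x2 x2').
Qed.

(** The interior of the cell is included in F, so that the boundary of a product
    cell lies in products of cells of such families. *)
Lemma cdisk_cells (E : topologicalType) (X : @cw_structure R E) (e : cw_cell X) :
  exists2 F : set (cw_cell X), finite_set F &
    (forall f, F f -> f = e \/ (cw_dim f < cw_dim e)%N) /\
    (forall u, @cdisk R (cw_dim e) u ->
       exists f, [/\ F f, cw_open f (cw_char u) & (f = e <-> @odisk R (cw_dim e) u)]).
Proof.
have [F finF [dF cF]] := cw_closure_finite (c := X) e.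
exists (F `|` [set e]); first by rewrite finite_setU; split.
split=> [f [/dF|/=]|u uc]; [by right | by left | ].
have [uo|uo] := pselect (@odisk R (cw_dim e) u).
  by exists e; split=> //; [right | exists u].
have [f Ff fu] : (\bigcup_(e' in F) cw_open e') (cw_char u) by apply: cF; exists u.
exists f; split=> //; [by left | split=> // fe].
by have := dF _ Ff; rewrite fe ltnn.
Qed.

Lemma prod_closure_finite (e : prod_cell) :
  exists2 F : set prod_cell, finite_set F &
    (forall e', F e' -> (prod_dim e' < prod_dim e)%N) /\
    @prod_char e @` (@cdisk R (prod_dim e) `\` @odisk R (prod_dim e))
      `<=` \bigcup_(e' in F) (@prod_char e' @` @odisk R (prod_dim e')).
Proof.
have [F1 fin1 [dF1 cF1]] := cdisk_cells e.1.
have [F2 fin2 [dF2 cF2]] := cdisk_cells e.2.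
exists ((F1 `*` F2) `\ e).
  by apply: (sub_finite_set (@subDsetl _ _ _)); exact: finite_setX.
split=> [[f1 f2] [[/= /dF1 d1 /dF2 d2] ne]|_ [u [/cdisk_submx[u1 u2] uo] <-]].
  case: d1 d2 => [e1|d1] [e2|d2].
  - by case: ne => /=; rewrite e1 e2; case: (e).
  - by rewrite /prod_dim /= e1 ltn_add2l.
  - by rewrite /prod_dim /= e2 ltn_add2r.
  - by rewrite /prod_dim /= -addnS leq_add// ltnW.
have [f1 [Ff1 o1 E1']] := cF1 _ u1; have [f2 [Ff2 o2 E2']] := cF2 _ u2.
exists (f1, f2); last by apply/prod_open.
split=> //= fe; apply: uo; apply/odisk_submx.
by split; [apply/E1'; exact: (congr1 fst fe) | apply/E2'; exact: (congr1 snd fe)].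
Qed.

Hypothesis lc1 : forall x : E1, exists2 B, compact B & nbhs x B.
Hypothesis lc2 : forall x : E2, exists2 B, compact B & nbhs x B.

(** The weak topology of a product is the product topology because of local
    compactness: near a point only finitely many closed cells matter, and the
    part of A in each of them is compact. *)
Lemma prod_weak (A : set (E1 * E2)) :
  (forall e, closed (@cdisk R (prod_dim e) `&` @prod_char e @^-1` A)) -> closed A.
Proof.
move=> Ae x Ax; have [B1 B1c xB1] := lc1 x.1; have [B2 B2c xB2] := lc2 x.2.
pose F : set prod_cell := [set e | cw_open e `&` B1 !=set0] `*` [set e | cw_open e `&` B2 !=set0].
have finF : finite_set F by apply: finite_setX; exact: compact_finite_cells.
pose Q := \bigcup_(e in F) (@prod_char e @` (@cdisk R (prod_dim e) `&` @prod_char e @^-1` A)).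
have clQ : closed Q.
  apply: closed_bigcup_finite => // e _; apply: compact_closed; first exact: prod_hausdorff.
  apply: continuous_compact.
    by apply: (continuous_subspaceW _ (@prod_char_continuous e)); exact: subIsetl.
  apply: (subclosed_compact _ (@cdisk_compact R (prod_dim e))); last exact: subIsetl.
  exact: Ae.
have QA : Q `<=` A by move=> _ [e _ [u [_ uA] <-]].
have ABQ : A `&` (B1 `*` B2) `<=` Q.
  move=> y [Ay [/= y1 y2]]; have [e ye] := prod_cover y.
  have /prod_open[y1o y2o] := ye.
  exists e; first by split; [exists y.1 | exists y.2].
  by case: ye => u uo uy; exists u => //; split; [exact: odisk_cdisk | rewrite /= uy].
apply: QA; apply: clQ => W Wx.
have [|y [Ay [By Wy]]] := Ax ((B1 `*` B2) `&` W).
  by apply: filterI => //; exists (B1, B2).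
by exists y; split=> //; apply: ABQ.
Qed.

Definition prod_cw : @cw_structure R (E1 * E2)%type :=
  @CWStructure R (E1 * E2)%type prod_cell prod_dim prod_char prod_hausdorff
    prod_char_continuous prod_char_injective prod_cover prod_disjoint
    prod_closure_finite prod_weak.

Lemma cellular_prod (f1 : E1 -> E1) (f2 : E2 -> E2) : cellular_map X1 f1 ->
  cellular_map X2 f2 -> cellular_map prod_cw (fun x => (f1 x.1, f2 x.2)).
Proof.
move=> [c1 s1] [c2 s2]; split.
  move=> [x1 x2]; apply: (@cvg_pair _ _ _ (nbhs (x1, x2))).
    by apply: (cvg_comp _ _ cvg_fst); exact: c1.
  by apply: (cvg_comp _ _ cvg_snd); exact: c2.
move=> k _ [x [[e1 e2] /= ek /prod_open[/= xe1 xe2]] <-].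
have [f1' d1 o1] : cw_skeleton X1 (cw_dim e1) (f1 x.1).
  by apply: s1; exists x.1 => //; exists e1 => //=.
have [f2' d2 o2] : cw_skeleton X2 (cw_dim e2) (f2 x.2).
  by apply: s2; exists x.2 => //; exists e2 => //=.
exists (f1', f2'); last by apply/prod_open.
by apply: leq_trans ek; exact: leq_add.
Qed.

End ProductCW.

Lemma compact_proj (E1 E2 : topologicalType) (C : set (E1 * E2)) : compact C ->
  [/\ compact (fst @` C), compact (snd @` C) & C `<=` (fst @` C) `*` (snd @` C)].
Proof.
move=> Cc; split.
- by apply: continuous_compact => //; apply: continuous_subspaceT => x; exact: cvg_fst.
- by apply: continuous_compact => //; apply: continuous_subspaceT => x; exact: cvg_snd.
- by move=> x Cx; split; exists x.
Qed.

Section ProductEG.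
Context {R : realType} {G1 G2 : groupType}.
Variables (E1 : EG_space R G1) (E2 : EG_space R G2).

Lemma EG_locally_compact (G : groupType) (E : EG_space R G) (x : E) :
  exists2 B, compact B & nbhs x B.
Proof.
exists [set y | mdist x y <= 1]; first exact: EG_proper_metric.
apply: (filterS _ (nbhsx_ballx x 1 ltr01)) => y.
by rewrite ballEmdist /= => /ltW.
Qed.

Definition EG_prod_cw : @cw_structure R (E1 * E2)%type :=
  prod_cw (EG_cw E1) (EG_cw E2) (@EG_locally_compact _ E1) (@EG_locally_compact _ E2).

Lemma EG_prod_contractible : @contractible R (E1 * E2)%type.
Proof.
have [x1 [F1 [c1 s1 t1]]] := EG_contractible E1.
have [x2 [F2 [c2 s2 t2]]] := EG_contractible E2.
exists (x1, x2), (fun z => (F1 (z.1, z.2.1), F2 (z.1, z.2.2))); split.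
- have cuv1 : {within I01 `*` setT, continuous (fun z : R * (E1 * E2) => (z.1, z.2.1))}.
    apply: within_continuous_pair; apply: continuous_subspaceT => z; first exact: cvg_fst.
    by apply: (@continuous_comp _ _ _ snd fst); [exact: cvg_snd | exact: cvg_fst].
  have cuv2 : {within I01 `*` setT, continuous (fun z : R * (E1 * E2) => (z.1, z.2.2))}.
    apply: within_continuous_pair; apply: continuous_subspaceT => z; first exact: cvg_fst.
    by apply: (@continuous_comp _ _ _ snd snd); exact: cvg_snd.
  by apply: (within_continuous_pair (within_continuous_precomp c1 cuv1 _)
    (within_continuous_precomp c2 cuv2 _)) => z [].
- by case=> y1 y2; rewrite /= s1 s2.
- by move=> y; rewrite /= t1 t2.
Qed.

Definition EG_prod_map (g : (G1 * G2)%type) (x : E1 * E2) : E1 * E2 :=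
  (EG_act E1 g.1 x.1, EG_act E2 g.2 x.2).

Lemma EG_prod_map1 x : EG_prod_map 1%g x = x.
Proof. by rewrite /EG_prod_map /= !lact1; case: x. Qed.

Lemma EG_prod_mapM g h x : EG_prod_map (g * h)%g x = EG_prod_map g (EG_prod_map h x).
Proof. by rewrite /EG_prod_map /= !lactM. Qed.

Definition EG_prod_act : left_action (G1 * G2)%type (E1 * E2)%type :=
  LeftAction EG_prod_map1 EG_prod_mapM.

Lemma EG_prod_proper (C : set (E1 * E2)) : compact C ->
  finite_set [set g | (EG_prod_act g @` C) `&` C !=set0].
Proof.
move=> /compact_proj[C1 C2 CC].
have := finite_setX (EG_proper C1) (EG_proper C2).
apply: sub_finite_set => -[g1 g2] [_ [[x Cx <-] Cy]]; have [] := CC _ Cy.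
move=> y1 y2; split; [exists (EG_act E1 g1 x.1) | exists (EG_act E2 g2 x.2)]; split=> //.
  by exists x.1 => //; exists x.
by exists x.2 => //; exists x.
Qed.

Lemma EG_prod_cocompact : exists2 C : set (E1 * E2), compact C &
  \bigcup_(g in [set: (G1 * G2)%type]) (EG_prod_act g @` C) = setT.
Proof.
have [C1 C1c C1T] := EG_cocompact E1; have [C2 C2c C2T] := EG_cocompact E2.
exists (C1 `*` C2); first exact: compact_setX.
apply/seteqP; split=> // -[x1 x2] _.
have : [set: E1] x1 by []. rewrite -C1T => -[g1 _ [y1 Cy1 <-]].
have : [set: E2] x2 by []. rewrite -C2T => -[g2 _ [y2 Cy2 <-]].
by exists (g1, g2) => //; exists (y1, y2).
Qed.

Lemma EG_prod_isometric g (x y : (E1 * E2)%type) :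
  mdist (EG_prod_act g x) (EG_prod_act g y) = mdist x y.
Proof. by rewrite /mdist /= /prod_mdist /= !EG_isometric. Qed.

Lemma EG_prod_proper_metric (x : (E1 * E2)%type) (r : R) :
  compact [set y | mdist x y <= r].
Proof.
have c1 : compact [set y | mdist x.1 y <= r] by exact: EG_proper_metric.
have c2 : compact [set y | mdist x.2 y <= r] by exact: EG_proper_metric.
have := compact_setX c1 c2.
congr compact; apply/seteqP; split=> y.
  by move=> [/= y1 y2]; rewrite /mdist /= /prod_mdist ge_max y1.
by rewrite /= /mdist /= /prod_mdist ge_max => /andP[].
Qed.

Definition EG_prod : EG_space R (G1 * G2)%type :=
  @EGSpace R (G1 * G2)%type (E1 * E2)%type EG_prod_cw EG_prod_contractible EG_prod_act
    (fun g => cellular_prod (@EG_locally_compact _ E1) (@EG_locally_compact _ E2)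
       (EG_cellular E1 g.1) (EG_cellular E2 g.2))
    EG_prod_proper EG_prod_cocompact EG_prod_isometric EG_prod_proper_metric.

End ProductEG.

(** * Cones as sets of nonnegative vectors *)

Section ConeCoordinates.
Context {R : realType}.

(** The cone on a simplex s is the orthant of the vectors with support in s. *)
Definition nnsupp m (s : {set 'I_m}) (y : 'rV[R]_m) : Prop :=
  (forall v, 0 <= y 0 v) /\ (forall v, v \notin s -> y 0 v = 0).

(** The coordinate in [0, oo) of a point of the cone. *)
Definition height m (y : 'rV[R]_m) : R := \sum_v y 0 v.

Lemma coord_le_height m (s : {set 'I_m}) y v : nnsupp s y -> y 0 v <= height y.
Proof.
move=> [y0 _]; rewrite /height (bigD1 v)//= lerDl; apply: sumr_ge0 => w _; exact: y0.
Qed.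

Lemma nnsupp0 m (s : {set 'I_m}) : nnsupp s 0.
Proof. by split=> [v|v _]; rewrite mxE. Qed.

Lemma nnsupp_set0 m (y : 'rV[R]_m) : nnsupp finset.set0 y -> y = 0.
Proof. by move=> [_ ys]; apply/rowP => v; rewrite mxE ys// inE. Qed.

Lemma height_set0 m (y : 'rV[R]_m) : nnsupp finset.set0 y -> height y = 0.
Proof. by move=> /nnsupp_set0 ->; rewrite /height big1// => v _; rewrite mxE. Qed.

Lemma ray_fromP m (s : {set 'I_m}) (r : R) (y : 'rV[R]_m) : 0 < r ->
  ray_from r (geo_simplex s) y <-> nnsupp s y /\ r <= height y.
Proof.
move=> r0; split=> [[t [x [rt [x0 x1 xs] ->]]]|[[y0 ys] ry]].
  have t0 : 0 <= t by apply: le_trans rt; exact: ltW.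
  split; first by split=> [v|v vs]; rewrite mxE; [exact: mulr_ge0 | rewrite xs ?mulr0].
  by rewrite /height; under eq_bigr do rewrite mxE; rewrite -big_distrr/= x1 mulr1.
have h0 : 0 < height y by exact: lt_le_trans ry.
have hN : height y != 0 by rewrite gt_eqF.
exists (height y), ((height y)^-1 *: y); split=> //; last by rewrite scalerA divff// scale1r.
split=> [v||v vs]; first by rewrite mxE mulr_ge0// invr_ge0 ltW.
  by rewrite -[RHS](mulVf hN) big_distrr/=; apply: eq_bigr => v _; rewrite mxE.
by rewrite mxE ys ?mulr0.
Qed.

Lemma geo_vertex m (s : {set 'I_m}) v : v \in s -> geo_simplex s (delta_mx 0 v : 'rV[R]_m).
Proof.
move=> vs; split=> [w||w ws]; rewrite ?mxE; first by rewrite ler0n.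
  rewrite (bigD1 v)//= mxE !eqxx big1 ?addr0// => w wv.
  by rewrite mxE (negPf wv) andbF.
by rewrite eqxx /=; case: (w =P v) => // wv; rewrite wv vs in ws.
Qed.

(** The simplex has to be nonempty, as otherwise the cone on it lacks the apex. *)
Lemma cone_simplexP m (s : {set 'I_m}) (y : 'rV[R]_m) : s != finset.set0 ->
  cone_simplex s y <-> nnsupp s y.
Proof.
move=> /set0Pn[v vs]; split=> [[t [x [t0 [x0 x1 xs] ->]]]|yn].
  by split=> [w|w ws]; rewrite mxE; [exact: mulr_ge0 | rewrite xs ?mulr0].
have [h0|h0] := ltP 0 (height y).
  have /(ray_fromP s y h0)[t [x [ht gx yE]]] : nnsupp s y /\ height y <= height y by [].
  by exists t, x; split=> //; apply: le_trans ht; exact: ltW.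
exists 0, (delta_mx 0 v); split=> //; first exact: geo_vertex.
rewrite scale0r; apply/rowP => w; rewrite mxE; apply/le_anti.
by rewrite (le_trans (coord_le_height w yn) h0); case: yn => ->.
Qed.

Lemma ConeP m (K : scomplex m) (y : 'rV[R]_m) :
  Cone K y <-> exists2 s, s \in simplices K & nnsupp s y.
Proof.
have s0 s : s \in simplices K -> s != finset.set0 by move=> sK; rewrite (simplex_set0F sK).
split=> [[t [x [t0 [s /= sK sx] ->]]]|[s sK /(cone_simplexP y (s0 s sK))[t [x [t0 sx ->]]]]].
  by exists s => //; apply/(cone_simplexP _ (s0 s sK)); exists t, x.
by exists t, x; split=> //; exists s.
Qed.

(** Faces of simplices of a join may be empty on one side, where only the apex
    remains. *)
Lemma nnsupp_Cone m (K : scomplex m) (s : {set 'I_m}) (y : 'rV[R]_m) :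
  (exists s, s \in simplices K) -> (s == finset.set0) || (s \in simplices K) ->
  nnsupp s y -> Cone K y.
Proof.
move=> [s0 s0K] /orP[/eqP ->|sK] ys; apply/ConeP; last by exists s.
by exists s0 => //; rewrite (nnsupp_set0 ys); exact: nnsupp0.
Qed.

Section JoinCone.
Context {m1 m2 : nat}.

Lemma nnsupp_join (s : {set 'I_(m1 + m2)}) (y : 'rV[R]_(m1 + m2)) :
  nnsupp s y <-> nnsupp (lpart s) (lsubmx y) /\ nnsupp (rpart s) (rsubmx y).
Proof.
split=> [[y0 ys]|[[l0 ls] [r0 rs]]].
  by split; split=> [v|v vs]; rewrite mxE//; apply: ys; move: vs; rewrite inE.
split; apply: ord_sumP => v.
- by have := l0 v; rewrite mxE.
- by have := r0 v; rewrite mxE.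
- by move=> vs; have := ls v; rewrite mxE; apply; rewrite inE.
- by move=> vs; have := rs v; rewrite mxE; apply; rewrite inE.
Qed.

Lemma height_join (y : 'rV[R]_(m1 + m2)) :
  height y = height (lsubmx y) + height (rsubmx y).
Proof.
by rewrite /height big_split_ord/=; congr (_ + _); apply: eq_bigr => i _; rewrite mxE.
Qed.

Variables (K1 : scomplex m1) (K2 : scomplex m2).
Hypothesis K1n : exists s, s \in simplices K1.
Hypothesis K2n : exists s, s \in simplices K2.

Lemma Cone_join (y : 'rV[R]_(m1 + m2)) :
  Cone (join K1 K2) y <-> Cone K1 (lsubmx y) /\ Cone K2 (rsubmx y).
Proof.
split.
  move=> /ConeP[s]; rewrite inE => /and3P[_ sl sr] /nnsupp_join[yl yr].
  by split; [exact: (nnsupp_Cone K1n sl) | exact: (nnsupp_Cone K2n sr)].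
move=> [/ConeP[s sK sy] /ConeP[t tK ty]]; apply/ConeP; exists (usum s t).
  rewrite inE parts_eq0 lpart_usum rpart_usum sK tK !orbT !andbT.
  by rewrite (simplex_set0F sK).
by apply/nnsupp_join; rewrite lpart_usum rpart_usum.
Qed.

End JoinCone.
End ConeCoordinates.

Lemma row_mx_continuous (R : realType) (m1 m2 : nat) :
  continuous (fun z : 'rV[R]_m1 * 'rV[R]_m2 => row_mx z.1 z.2).
Proof.
move=> [u v] A /nbhs_ballP[e /= e0 eA].
apply/nbhs_ballP; exists e => //= -[u' v'] [/= [_ uu] [_ vv]]; apply: eA; split=> // i j.
by case: (split_ordP j) => k ->; rewrite ?row_mxEl ?row_mxEr; [exact: uu | exact: vv].
Qed.

Lemma height_continuous (R : realType) (m : nat) : continuous (@height R m).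
Proof.
apply: continuous_big; first exact: add_continuous.
by move=> v _; exact: coord_continuous.
Qed.

(** * Products of maps from cones *)

Lemma mdist_continuous (R : realType) (E : metricType R) (x0 : E) :
  continuous (mdist x0 : E -> R).
Proof.
move=> x; apply/cvgrPdist_lt => e e0.
near=> y.
have xy : mdist x y < e.
  by have : ball x e y; [near: y; exact: nbhsx_ballx | rewrite ballEmdist].
have h1 := metric_triangle x0 x y; have := metric_triangle x0 y x.
by rewrite (metric_sym y) ltr_norml => h2; apply/andP; split; lra.
Unshelve. all: by end_near. Qed.

Lemma compact_mdist_bounded (R : realType) (E : metricType R) (x0 : E) (C : set E) :
  compact C -> exists M, forall x, C x -> mdist x0 x <= M.
Proof.
move=> Cc; have [->|/set0P C0] := eqVneq C classical_sets.set0; first by exists 0.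
have [c _ cM] := compact_EVT_max C0 Cc (continuous_subspaceT (@mdist_continuous R E x0)).
by exists (mdist x0 c) => x Cx; apply: cM; rewrite inE.
Qed.

(** Properness of a map to a product, where D stands for a compact set that
    contains the preimage of the product of C1 and C2. *)
Lemma proper_on_dominated (X Y1 Y2 : topologicalType) (A : set X) (f : X -> Y1 * Y2) :
  hausdorff_space X -> hausdorff_space (Y1 * Y2)%type -> {within A, continuous f} ->
  (forall (C1 : set Y1) (C2 : set Y2), compact C1 -> compact C2 ->
    exists2 D : set X, compact D & D `<=` A /\
      (forall x, A x -> C1 (f x).1 -> C2 (f x).2 -> D x)) ->
  proper_on A f.
Proof.
move=> hX hY fc dom; split=> // C Cc; have [C1 C2 CC] := compact_proj Cc.
have [D Dc [DA AD]] := dom _ _ C1 C2.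
have clD : closed D by apply: compact_closed.
rewrite (_ : A `&` f @^-1` C = D `&` f @^-1` C).
  apply: (subclosed_compact _ Dc); last exact: subIsetl.
  apply: within_closed_preimage => //; last exact: compact_closed.
  exact: continuous_subspaceW fc.
apply/seteqP; split=> x [Ax fx]; split=> //; last exact: DA.
by have [c1 c2] := CC _ fx; exact: AD.
Qed.

Section JoinMaps.
Context {R : realType} {G1 G2 : groupType}.
Variables (E1 : EG_space R G1) (E2 : EG_space R G2).
Context {m1 m2 : nat}.
Variables (K1 : scomplex m1) (K2 : scomplex m2).
Hypothesis K1n : exists s, s \in simplices K1.
Hypothesis K2n : exists s, s \in simplices K2.
Variables (f1 : 'rV[R]_m1 -> E1) (f2 : 'rV[R]_m2 -> E2).

Definition join_cone_map (x : 'rV[R]_(m1 + m2)) : EG_prod E1 E2 :=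
  (f1 (lsubmx x), f2 (rsubmx x)).

Lemma EG_prod_hausdorff : hausdorff_space (E1 * E2)%type.
Proof. exact: metric_hausdorff. Qed.

Lemma within_lsubmx (A : set 'rV[R]_(m1 + m2)) :
  {within A, continuous (fun x : 'rV[R]_(m1 + m2) => lsubmx x)}.
Proof. by apply: continuous_subspaceT; exact: continuous_lsubmx. Qed.

Lemma within_rsubmx (A : set 'rV[R]_(m1 + m2)) :
  {within A, continuous (fun x : 'rV[R]_(m1 + m2) => rsubmx x)}.
Proof. by apply: continuous_subspaceT; exact: continuous_rsubmx. Qed.

Lemma join_cone_map_proper : proper_on (Cone K1) f1 -> proper_on (Cone K2) f2 ->
  proper_on (Cone (join K1 K2)) join_cone_map.
Proof.
move=> [c1 p1] [c2 p2]; apply: (@proper_on_dominated _ E1 E2).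
- exact: norm_hausdorff.
- exact: EG_prod_hausdorff.
- by apply: (within_continuous_pair (within_continuous_precomp c1 (@within_lsubmx _) _)
    (within_continuous_precomp c2 (@within_rsubmx _) _)) => x /(Cone_join K1n K2n)[].
move=> C1 C2 /p1 B1c /p2 B2c.
exists ((fun z : 'rV[R]_m1 * 'rV[R]_m2 => row_mx z.1 z.2) @`
    ((Cone K1 `&` f1 @^-1` C1) `*` (Cone K2 `&` f2 @^-1` C2))).
  apply: continuous_compact; last exact: compact_setX.
  by apply: continuous_subspaceT; exact: row_mx_continuous.
split=> [_ [[u v] [[/= Ku _] [Kv _]] <-]|x /(Cone_join K1n K2n)[Kl Kr] /= fl fr].
  by apply/(Cone_join K1n K2n); rewrite row_mxKl row_mxKr.
by exists (lsubmx x, rsubmx x); rewrite ?hsubmxK.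
Qed.

End JoinMaps.

Section Expanding.
Context {R : realType}.

Lemma expandingP m (K : scomplex m) (E : metricType R) (f : 'rV[R]_m -> E) :
  expanding K f <->
  forall s t : {set 'I_m}, s \in simplices K -> t \in simplices K -> [disjoint s & t]%B ->
  forall D : R, exists2 r, 0 < r & forall x y, nnsupp s x -> nnsupp t y ->
    r <= height x -> r <= height y -> D <= mdist (f x) (f y).
Proof.
split=> [fe s t sK tK st D|fe s t sK tK st].
  have /cvgeyPge/(_ D)[M [_ MD]] := fe s t sK tK st.
  exists (Num.max (M + 1) 1); first by rewrite lt_max ltr01 orbT.
  move=> x y xs yt hx hy; rewrite -lee_fin.
  have M1 : M < Num.max (M + 1) 1 by rewrite lt_max ltrDl ltr01.
  apply: le_trans (MD _ M1) _; apply: ereal_inf_lbound.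
  have r0 : 0 < Num.max (M + 1) 1 :> R by rewrite lt_max ltr01 orbT.
  exists (f x), (f y); split=> //; [exists x => //|exists y => //];
  exact/(ray_fromP _ _ r0).
apply/cvgeyPge => D; have [r r0 rD] := fe s t sK tK st D.
exists r; split; first exact: num_real.
move=> r' rr'; have r'0 : 0 < r' by exact: lt_trans rr'.
apply: le_ereal_inf_tmp => _ [_ [_ [[x /(ray_fromP _ _ r'0)[xs hx] <-]
  [y /(ray_fromP _ _ r'0)[yt hy] <-] ->]]].
by rewrite lee_fin; apply: rD => //; apply: le_trans (ltW rr') _.
Qed.

Lemma nnsupp_bounded_compact m (s : {set 'I_m}) (r : R) : 0 <= r ->
  exists2 B : set 'rV[R]_m, compact B & (B `<=` nnsupp s) /\
    (forall y, nnsupp s y -> height y <= r -> B y).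
Proof.
move=> r0; pose A (i : 'I_m) : set R := if i \in s then `[0, r] else `[0, 0].
exists [set y : 'rV[R]_m | forall i, A i (y 0 i)].
  by apply: rV_compact => i; rewrite /A; case: ifP => _; exact: segment_compact.
split=> [y Ay|y ys yr i].
  split=> [i|i iN]; have := Ay i; rewrite /A.
    by case: ifP => _; rewrite /= in_itv /= => /andP[].
  by rewrite (negPf iN) /= in_itv /= => /andP[y1 y2]; apply/le_anti; rewrite y1 y2.
rewrite /A; have [y0 yz] := ys; case: ifPn => [_|/yz ->]; rewrite /= in_itv /= ?lexx//.
by rewrite y0 (le_trans _ yr)// (coord_le_height _ ys).
Qed.

(** A point far out in the cone on one simplex is far from the whole cone on a
    disjoint simplex: from its far part because f is expanding, and from its
    bounded part because f is proper.  In a join, points far out may be so in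
    one of the two factors only, and then nothing is known about the height of
    the other point in this factor. *)
Lemma expanding_one_sided m (K : scomplex m) (G : groupType) (E : EG_space R G)
    (f : 'rV[R]_m -> E) (s t : {set 'I_m}) (D : R) :
  (exists s, s \in simplices K) -> proper_on (Cone K) f -> expanding K f ->
  (s == finset.set0) || (s \in simplices K) -> (t == finset.set0) || (t \in simplices K) ->
  [disjoint s & t]%B ->
  exists2 r, 0 < r & forall x y, nnsupp s x -> nnsupp t y ->
    r <= height x -> D <= mdist (f x) (f y).
Proof.
move=> Kn [fc fp] /expandingP fe sJ tJ st.
have [r1 r10 far] : exists2 r, 0 < r & forall x y, nnsupp s x -> nnsupp t y ->
    r <= height x -> r <= height y -> D <= mdist (f x) (f y).
  case/orP: (sJ) => [/eqP s0|sK].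
    by exists 1 => // x y; rewrite s0 => /height_set0 ->; rewrite ler10.
  case/orP: (tJ) => [/eqP t0|tK]; last exact: fe.
  by exists 1 => // x y _; rewrite t0 => /height_set0 ->; rewrite ler10.
have [B Bc [Bt tB]] := nnsupp_bounded_compact t (ltW r10).
have BK : B `<=` Cone K by move=> y /Bt; exact: nnsupp_Cone.
have fBc : compact (f @` B) by apply: continuous_compact => //; exact: continuous_subspaceW fc.
have [M fM] := compact_mdist_bounded (f 0) fBc.
(* The part of the cone on t below r1 is mapped to the ball of radius M; a point
   at distance less than D from it is in the ball of radius M + D, the preimage
   of which lies below r2. *)
have ball_c : compact [set z | mdist (f 0) z <= M + D] by exact: EG_proper_metric.
have := fp _ ball_c; set C := _ `&` _ => Cc.
have [r2 hr2] : exists r, forall x, C x -> height x <= r.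
  have [->|/set0P C0] := eqVneq C classical_sets.set0; first by exists 0.
  have [c _ cM] := compact_EVT_max C0 Cc (continuous_subspaceT (@height_continuous R m)).
  by exists (height c) => x Cx; apply: cM; rewrite inE.
exists (Num.max r1 (r2 + 1)); first by rewrite lt_max r10.
move=> x y xs yt; rewrite ge_max => /andP[hx1 hx2].
have [hy|hy] := leP r1 (height y); first exact: far.
rewrite leNgt; apply/negP => xy.
have : C x.
  split; first exact: nnsupp_Cone xs.
  rewrite /= (le_trans (metric_triangle _ (f y) _))// lerD//.
    by apply: fM; exists y => //; apply: tB => //; exact: ltW.
  by rewrite metric_sym ltW.
by move=> /hr2; rewrite leNgt => /negP; apply; apply: lt_le_trans hx2; rewrite ltrDl.
Qed.

End Expanding.

Section JoinPreserving.
Context {R : realType} {G1 G2 : groupType}.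
Variables (E1 : EG_space R G1) (E2 : EG_space R G2).
Context {m1 m2 : nat}.
Variables (K1 : scomplex m1) (K2 : scomplex m2).
Hypothesis K1n : exists s, s \in simplices K1.
Hypothesis K2n : exists s, s \in simplices K2.
Variables (f1 : 'rV[R]_m1 -> E1) (f2 : 'rV[R]_m2 -> E2).

Lemma join_cone_map_expanding : proper_on (Cone K1) f1 -> proper_on (Cone K2) f2 ->
  expanding K1 f1 -> expanding K2 f2 ->
  expanding (join K1 K2) (join_cone_map f1 f2).
Proof.
move=> p1 p2 e1 e2; apply/expandingP => s t.
rewrite !inE => /and3P[_ sl sr] /and3P[_ tl tr]; rewrite disjoint_parts => /andP[dl dr] D.
have [r1 r10 far1] := expanding_one_sided D K1n p1 e1 sl tl dl.
have [r2 r20 far2] := expanding_one_sided D K2n p2 e2 sr tr dr.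
exists (r1 + r2); first exact: addr_gt0.
move=> x y /nnsupp_join[xl xr] /nnsupp_join[yl yr]; rewrite height_join => hx _.
rewrite /mdist /= /prod_mdist le_max; apply/orP.
have [h1|h1] := leP r1 (height (lsubmx x)); first by left; exact: far1.
right; apply: far2 => //; rewrite leNgt; apply/negP => h2.
by move: hx; rewrite leNgt (ltrD h1 h2).
Qed.

(** The neighbourhood condition extended to the empty simplex, on the cone of
    which, the apex, it holds with another bound by compactness of the interval. *)
Lemma H_preserving_all (G : groupType) (E : EG_space R G) (H : finGroupType) m
    (K : scomplex m) (a : Hcomplex H K) (f : 'rV[R]_m -> E) (h : H) :
  (exists s, s \in simplices K) -> H_preserving a f ->
  exists (g : G) (r : R) (j : R * 'rV[R]_m -> E),
    [/\ square_subgroup h -> square_subgroup g,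
        proper_on (I01 `*` Cone K) j,
        (forall x, Cone K x -> j (0, x) = f (cone_act a h x)),
        (forall x, Cone K x -> j (1, x) = EG_act E g (f x))
      & forall u s x, I01 u -> (s == finset.set0) || (s \in simplices K) -> nnsupp s x ->
          exists2 x', nnsupp s x' & mdist (j (u, x)) (f (cone_act a h x')) < r].
Proof.
move=> Kn /(_ h)[g [r [j [hg r0 jp [j0 j1] jn]]]].
have v0K : Cone K (0 : 'rV[R]_m).
  have e0 : (finset.set0 == finset.set0 :> {set 'I_m}) || (finset.set0 \in simplices K).
    by rewrite eqxx.
  exact: (nnsupp_Cone Kn e0 (nnsupp0 _)).
have cI : {within I01, continuous (fun u : R => (u, 0 : 'rV[R]_m))}.
  apply: within_continuous_pair; apply: continuous_subspaceT => u; first exact: cvg_id.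
  exact: cvg_cst.
have jIc : compact ((fun u : R => j (u, 0)) @` I01).
  apply: continuous_compact; last exact: segment_compact.
  by apply: (within_continuous_precomp (proj1 jp) cI) => u Iu.
have [M jM] := compact_mdist_bounded (f (cone_act a h 0)) jIc.
exists g, (Num.max r (M + 1)), j; split=> // u s x Iu /orP[/eqP ->|sK] xs.
  exists 0; first exact: nnsupp0.
  rewrite (nnsupp_set0 xs) metric_sym lt_max; apply/orP; right.
  rewrite (le_lt_trans (jM (j (u, 0)) _)) ?ltrDl//; first by exists u.
have sn : s != finset.set0 by rewrite (simplex_set0F sK).
have [|_ [x' /(cone_simplexP _ sn) xs' <-] d] := jn u s Iu sK (j (u, x)).
  by exists x => //; exact/cone_simplexP.
by exists x' => //; rewrite lt_max d.
Qed.

Variables (H1 H2 : finGroupType) (a1 : Hcomplex H1 K1) (a2 : Hcomplex H2 K2).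

Lemma cone_act_join (h : (H1 * H2)%type) (x : 'rV[R]_(m1 + m2)) :
  lsubmx (cone_act (join_complex a1 a2) h x) = cone_act a1 h.1 (lsubmx x) /\
  rsubmx (cone_act (join_complex a1 a2) h x) = cone_act a2 h.2 (rsubmx x).
Proof.
by split; apply/rowP => i; rewrite !mxE /= /join_map ?sum_map_l ?sum_map_r.
Qed.

Lemma join_cone_map_preserving : H_preserving a1 f1 -> H_preserving a2 f2 ->
  H_preserving (join_complex a1 a2) (join_cone_map f1 f2).
Proof.
move=> hp1 hp2 h.
have [g1 [r1 [j1 [sq1 jp1 j10 j11 n1]]]] := H_preserving_all h.1 K1n hp1.
have [g2 [r2 [j2 [sq2 jp2 j20 j21 n2]]]] := H_preserving_all h.2 K2n hp2.
pose pl (z : R * 'rV[R]_(m1 + m2)) : R * 'rV[R]_m1 := (z.1, lsubmx z.2).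
pose pr (z : R * 'rV[R]_(m1 + m2)) : R * 'rV[R]_m2 := (z.1, rsubmx z.2).
exists (g1, g2), (Num.max 1 (Num.max r1 r2)), (fun z => (j1 (pl z), j2 (pr z))); split.
- by move=> /square_subgroup_proj[/sq1 s1 /sq2 s2]; exact: square_subgroup_pair.
- by rewrite lt_max ltr01.
- apply: (@proper_on_dominated _ E1 E2).
  + exact: norm_hausdorff.
  + exact: EG_prod_hausdorff.
  + have cl : {within I01 `*` Cone (join K1 K2), continuous pl}.
      apply: within_continuous_pair; apply: continuous_subspaceT => z; first exact: cvg_fst.
      by apply: (@continuous_comp _ _ _ snd lsubmx); [exact: cvg_snd | exact: continuous_lsubmx].
    have cr : {within I01 `*` Cone (join K1 K2), continuous pr}.
      apply: within_continuous_pair; apply: continuous_subspaceT => z; first exact: cvg_fst.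
      by apply: (@continuous_comp _ _ _ snd rsubmx); [exact: cvg_snd | exact: continuous_rsubmx].
    by apply: (within_continuous_pair (within_continuous_precomp (proj1 jp1) cl _)
      (within_continuous_precomp (proj1 jp2) cr _)) => z [Iz /(Cone_join K1n K2n)[]].
  move=> C1 C2 /(proj2 jp1) B1c /(proj2 jp2) B2c.
  have [_ S1 _] := compact_proj B1c; have [_ S2 _] := compact_proj B2c.
  (* The time coordinates of the two preimages need not agree, but only their
   projections to the cones matter. *)
  exists (I01 `*` ((fun z : 'rV[R]_m1 * 'rV[R]_m2 => row_mx z.1 z.2) @`
      ((snd @` ((I01 `*` Cone K1) `&` j1 @^-1` C1)) `*`
       (snd @` ((I01 `*` Cone K2) `&` j2 @^-1` C2))))).
    apply: compact_setX; first exact: segment_compact.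
    apply: continuous_compact; last exact: compact_setX.
    by apply: continuous_subspaceT; exact: row_mx_continuous.
  split=> [[u _] [/= Iu [[x y] [/= [[_ x'] [[/= _ Kx] _] <-]
      [[_ y'] [[/= _ Ky] _] <-]] <-]]|[u x] [/= Iu /(Cone_join K1n K2n)[Kl Kr]] c1 c2].
    by split=> //; apply/(Cone_join K1n K2n); rewrite row_mxKl row_mxKr.
  split=> //; exists (lsubmx x, rsubmx x); last by rewrite /= hsubmxK.
  by split; [exists (pl (u, x)) | exists (pr (u, x))].
- split=> x /(Cone_join K1n K2n)[xl xr].
    by have [cl cr] := cone_act_join h x; rewrite /pl /pr /= j10// j20// /join_cone_map cl cr.
  by rewrite /pl /pr /= j11// j21.
move=> u s Iu sK; have sn : s != finset.set0 by rewrite (simplex_set0F sK).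
move=> _ [x /(cone_simplexP _ sn)/nnsupp_join[xl xr] <-].
move: sK; rewrite inE => /and3P[_ sl sr].
have [xl' xls d1] := n1 u _ _ Iu sl xl; have [xr' xrs d2] := n2 u _ _ Iu sr xr.
have [cl cr] := cone_act_join h (row_mx xl' xr').
exists (join_cone_map f1 f2 (cone_act (join_complex a1 a2) h (row_mx xl' xr'))).
  exists (row_mx xl' xr') => //; apply/(cone_simplexP _ sn)/nnsupp_join.
  by rewrite row_mxKl row_mxKr.
rewrite /mdist /= /prod_mdist /join_cone_map cl cr row_mxKl row_mxKr gt_max.
by rewrite !lt_max d1 d2 !orbT.
Qed.

End JoinPreserving.

Lemma equivariant_obstructor_simplex m (K : scomplex m) (H : finGroupType)
    (a : Hcomplex H K) n : equivariant_obstructor a n -> exists s, s \in simplices K.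
Proof.
move=> [c [_ _ [lam _ vk] _] _]; apply: contrapT => Kn; move/eqP: vk; apply.
rewrite /vk_pairing big1// => p; rewrite !inE => /andP[/and3P[p1 _ _] _].
by case: Kn; exists p.1.
Qed.

(** * The inequality *)

Lemma ereal_supD_le (R : realType) (A B : set (\bar R)) (Z : \bar R) :
  (forall a, A a -> a \is a fin_num) -> (forall b, B b -> b \is a fin_num) ->
  (forall a b, A a -> B b -> (a + b <= Z)%E) -> (ereal_sup A + ereal_sup B <= Z)%E.
Proof.
move=> Af Bf ABZ.
have [->|/set0P[a0 Aa0]] := eqVneq A classical_sets.set0.
  by rewrite ereal_sup0 addNye leNye.
have [->|/set0P[b0 Bb0]] := eqVneq B classical_sets.set0.
  by rewrite ereal_sup0 addeNy leNye.
have sup_le b : B b -> (ereal_sup A <= Z - b)%E.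
  by move=> Bb; apply: ge_ereal_sup => a Aa; rewrite leeBrDr ?Bf// ABZ.
have [Zy|Zy] := eqVneq Z +oo%E; first by rewrite Zy leey.
have Zf : Z \is a fin_num.
  rewrite fin_numE Zy andbT; apply/eqP => ZN; have := ABZ _ _ Aa0 Bb0.
  have ab : (a0 + b0)%E \is a fin_num by rewrite fin_numD Af ?Bf.
  by rewrite ZN leeNy_eq => /eqP abN; rewrite abN in ab.
have supAf : ereal_sup A \is a fin_num.
  rewrite fin_numElt; apply/andP; split.
    by apply: lt_le_trans (ereal_sup_ubound Aa0); rewrite ltNye_eq Af.
  by apply: le_lt_trans (sup_le _ Bb0) _; rewrite ltey_eq fin_numB Zf Bf.
rewrite addeC -leeBrDr//; apply: ge_ereal_sup => b Bb.
by rewrite leeBrDr// addeC -leeBrDr ?Bf// sup_le.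
Qed.

Theorem theorem5p6 (R : realType) (G1 G2 : groupType)
    (fg1 : finitely_generated G1) (fg2 : finitely_generated G2)
    (E1 : EG_space R G1) (E2 : EG_space R G2) :
  (eqobdim R G1 + eqobdim R G2 - 1 <= eqobdim R (G1 * G2)%type)%E.
Proof.
rewrite leeBlDr//; apply: ereal_supD_le; [by move=> _ [n _ <-] | by move=> _ [n _ <-] |].
move=> _ b [n1 [H1 [m1 [L1 [a1 [F1 [f1 [ob1 p1 e1 h1]]]]]]] <-].
move=> [n2 [H2 [m2 [L2 [a2 [F2 [f2 [ob2 p2 e2 h2]]]]]]] <-].
have L1n := equivariant_obstructor_simplex ob1.
have L2n := equivariant_obstructor_simplex ob2.
rewrite -leeBlDr//; apply: ereal_sup_ubound; exists (n1 + n2 + 2)%N; last first.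
  by rewrite -EFinD; congr EFin; rewrite !natrD; ring.
exists (H1 * H2)%type, (m1 + m2)%N, (join L1 L2), (join_complex a1 a2), (EG_prod F1 F2),
  (join_cone_map f1 f2); split.
- exact: equivariant_obstructor_join.
- exact: join_cone_map_proper.
- exact: join_cone_map_expanding.
- exact: join_cone_map_preserving.
Qed.
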